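(* Let $1\le d<k$ and let $\mathcal{T}=(\mathbf{v}_1,\dots,\mathbf{v}_k)$ be a basis of $\mathbb{R}^k$ such that $\mathbf{v}_i\in\{\mathbf{e}_1,\dots,\mathbf{e}_k\}$ for each $i=d+1,\dots,k$, and such that $\mathbf{v}_1,\dots,\mathbf{v}_d$ is strongly Diophantine with respect to $\mathcal{T}$. Then for every $\delta>0$ there is $C>0$ such that for all $\mathbf{x}$, all $T>1$, and all parallelotopes $U\subset\mathbb{T}^k$ aligned with $\mathcal{T}$ with sidelengths bounded above by $\eta$, $$\big|N_T(U,\mathbf{x})-|U|\,|B_T|\big|\le C(1+\eta)^k\,T^\delta.$$
   Context: $\mathbb{T}^k=\mathbb{R}^k/\mathbb{Z}^k$, $\pi:\mathbb{R}^k\to\mathbb{T}^k$ is the canonical projection, and $\mathbf{e}_1,\dots,\mathbf{e}_k$ is the standard basis of $\mathbb{R}^k$. $V=\mathrm{span}(\mathbf{v}_1,\dots,\mathbf{v}_d)$, and $B_T=\{\sum_{i=1}^d a_i\mathbf{v}_i:\max_i|a_i|\le T\}$. $|\cdot|$ denotes Lebesgue measure (on $\mathbb{T}^k$ for $U$, on $V$ for $B_T$), and $N_T(U,\mathbf{x})=\int_{B_T}\chi_U(\pi(\mathbf{x}+\mathbf{t}))\,d\mathbf{t}$ for $\mathbf{x}\in\mathbb{R}^k$ (this depends only on $\pi(\mathbf{x})\in\mathbb{T}^k$). $\|\mathbf{m}\|$ is the sup-norm. For a basis $\mathcal{T}=(\mathbf{t}_1,\dots,\mathbf{t}_k)$ of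 $\mathbb{R}^k$, let $r_{\mathcal{T}}(\mathbf{m})=\prod_{i=1}^k\min\left(1,\frac{1}{|\mathbf{t}_i\cdot\mathbf{m}|}\right)$ (with $1/0=\infty$). The vectors $\mathbf{v}_1,\dots,\mathbf{v}_d$ are strongly Diophantine with respect to $\mathcal{T}$ if for every $\varepsilon>0$ there is $C>0$ such that for every $M>0$, $$\sum_{\mathbf{m}\in\mathbb{Z}^k\setminus\{0\},\ \|\mathbf{m}\|\le M} r_{\mathcal{T}}(\mathbf{m})\prod_{i=1}^d\frac{1}{|\mathbf{m}\cdot\mathbf{v}_i|}\le C M^\varepsilon .$$ $U\subset\mathbb{T}^k$ is a parallelotope aligned with $\mathcal{T}$ if $U=\pi(\tilde U+\mathbf{y})$ for some $\mathbf{y}\in\mathbb{R}^k$ and $\tilde U=\{\sum_{i=1}^k a_i\mathbf{t}_i: a_i\in[0,b_i]\ \forall i\}$ with $b_1,\dots,b_k>0$, where $\pi$ is injective on $\tilde U+\mathbf{y}$. Its sidelengths are the Euclidean lengths of the vectors $b_i\mathbf{t}_i$. *)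

(* Defs.v *)
From HB Require Import structures.
From mathcomp Require Import all_boot all_order all_algebra ring_quotient.
From mathcomp Require Import all_classical all_reals all_analysis.
From mathcomp Require Import measurable_realfun.

Set Implicit Arguments.
Unset Strict Implicit.
Unset Printing Implicit Defensive.

Import Order.TTheory GRing.Theory Num.Theory.
Import numFieldNormedType.Exports.

Local Open Scope classical_set_scope.
Local Open Scope ring_scope.

(* Euclidean space R^n is ['rV[R]_n], with its product sigma-algebra, generated
   by the coordinate maps. *)
Section measurable_rV.
Context {R : realType} {n : nat}.

Definition rV_coord (i : 'I_n) (x : 'rV[R]_n) : measurableTypeR R := x 0 i.

Let rV_set0 : g_sigma_preimage rV_coord set0.
Proof. exact: sigma_algebra0. Qed.

Let rV_setC A : g_sigma_preimage rV_coord A -> g_sigma_preimage rV_coord (~` A).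
Proof. exact: sigma_algebraC. Qed.

Let rV_bigcup (F : (set 'rV[R]_n)^nat) :
  (forall i, g_sigma_preimage rV_coord (F i)) ->
  g_sigma_preimage rV_coord (\bigcup_i (F i)).
Proof. exact: sigma_algebra_bigcup. Qed.

HB.instance Definition _ :=
  @isMeasurable.Build default_measure_display 'rV[R]_n
    (g_sigma_preimage rV_coord) rV_set0 rV_setC rV_bigcup.

End measurable_rV.

Lemma measurable_rV_coord (R : realType) n (i : 'I_n) :
  measurable_fun [set: 'rV[R]_n] (rV_coord i).
Proof.
move=> _ Y mY; rewrite setTI; apply: sub_sigma_algebra => /=.
rewrite -bigcup_seq/=; exists i => /=; first by rewrite mem_index_enum.
by exists Y => //; rewrite setTI.
Qed.

Lemma measurable_fun_rVP d (T : measurableType d) (R : realType) n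
    (f : T -> 'rV[R]_n) :
  measurable_fun [set: T] f <->
  forall i, measurable_fun [set: T] (rV_coord i \o f).
Proof.
split=> [mf i|mf].
  by apply: measurableT_comp => //; exact: measurable_rV_coord.
move=> _ A mA; rewrite setTI.
suff : g_sigma_preimage (@rV_coord R n) `<=`
  [set B | measurable (f @^-1` B)] by apply.
apply: smallest_sub.
- split=> /=.
  + by rewrite preimage_set0.
  + by move=> B mB; rewrite setTD preimage_setC; exact: measurableC.
  + by move=> F mF; rewrite preimage_bigcup; exact: bigcup_measurable.
- move=> B; rewrite -bigcup_seq /= => -[i _ [C mC <-]].
  by have := mf i measurableT C mC; rewrite !setTI.
Qed.

(* The library's canonical [SigmaFiniteMeasure] instance on [m1 \x m2] only
   covers subprobability measures. *)
Lemma sigma_finite_product d1 d2 (T1 : measurableType d1)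
    (T2 : measurableType d2) (R : realType)
    (m1 : SigmaFiniteMeasure.type T1 R) (m2 : SigmaFiniteMeasure.type T2 R) :
  sigma_finite setT (m1 \x m2)%E.
Proof.
have /sigma_finiteP[F [TF ndF Foo]] := sigma_finiteT m1.
have /sigma_finiteP[G [TG ndG Goo]] := sigma_finiteT m2.
exists (fun n => F n `*` G n).
  rewrite -setXTT TF TG predeqE => -[x y]; split.
    move=> [/= [n _ Fnx] [k _ Gky]]; exists (maxn n k) => //; split.
    - by move: x Fnx; exact/subsetPset/ndF/leq_maxl.
    - by move: y Gky; exact/subsetPset/ndG/leq_maxr.
  by move=> [n _ []/= ? ?]; split; exists n.
move=> k; have [? ?] := Foo k; have [? ?] := Goo k.
split; first exact: measurableX.
by rewrite product_measure1E// lte_mul_pinfty// ge0_fin_numE.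
Qed.

Section lebesgue_rV.
Context {R : realType}.

Definition rV_cons n (z : measurableTypeR R * 'rV[R]_n) : 'rV[R]_n.+1 :=
  \row_i (if unlift ord0 i is Some j then z.2 0 j else z.1).

Lemma measurable_rV_cons n : measurable_fun setT (@rV_cons n).
Proof.
apply/measurable_fun_rVP => i; case: (unliftP ord0 i) => [j|] ->.
- rewrite (_ : _ \o _ = rV_coord j \o snd); last first.
    by apply/funext => z /=; rewrite /rV_coord mxE liftK.
  by apply: measurableT_comp => //; exact: measurable_rV_coord.
- rewrite (_ : _ \o _ = fst); first exact: measurable_fst.
  by apply/funext => z /=; rewrite /rV_coord mxE unlift_none.
Qed.

Section step.
Variables (n : nat) (mu : {sigma_finite_measure set 'rV[R]_n -> \bar R}).

Definition lebesgue_rV_step : set 'rV[R]_n.+1 -> \bar R :=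
  pushforward (lebesgue_measure \x mu)%E (@rV_cons n).

Let step0 : lebesgue_rV_step set0 = 0%E.
Proof. by rewrite /lebesgue_rV_step /pushforward preimage_set0 measure0. Qed.

Let step_ge0 A : (0 <= lebesgue_rV_step A)%E.
Proof. by rewrite /lebesgue_rV_step /pushforward; exact: measure_ge0. Qed.

Let step_sigma_additive : semi_sigma_additive lebesgue_rV_step.
Proof.
apply: (measure_semi_sigma_additive (s := pushforward _ _)).
exact: measurable_rV_cons.
Qed.

HB.instance Definition _ := isMeasure.Build _ _ _ lebesgue_rV_step
  step0 step_ge0 step_sigma_additive.

Let step_sigma_finite : sigma_finite setT lebesgue_rV_step.
Proof.
have [F TF Foo] : sigma_finite setT (@lebesgue_measure R \x mu)%E.
  exact: sigma_finite_product.
pose tl (y : 'rV[R]_n.+1) : 'rV[R]_n := \row_j y 0 (lift ord0 j).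
pose unc (y : 'rV[R]_n.+1) : measurableTypeR R * 'rV[R]_n := (y 0 0, tl y).
have munc : measurable_fun setT unc.
  apply/measurable_fun_pairP; split; first exact: (measurable_rV_coord 0).
  apply/measurable_fun_rVP => j.
  rewrite (_ : _ \o _ = rV_coord (lift ord0 j)); first exact: measurable_rV_coord.
  by apply/funext => y; rewrite /= /rV_coord mxE.
exists (fun k => unc @^-1` F k) => [|k].
  by rewrite -preimage_bigcup -TF preimage_setT.
have [mF Fk] := Foo k; split; first by rewrite -[X in measurable X]setTI; exact: munc.
rewrite /lebesgue_rV_step /pushforward -comp_preimage.
rewrite (_ : unc \o _ = id)// ; apply/funext => -[x y] /=; congr pair.
  by rewrite mxE unlift_none.
by apply/rowP => j; rewrite !mxE liftK.
Qed.

HB.instance Definition _ := Measure_isSigmaFinite.Build _ _ _ lebesgue_rV_step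
  step_sigma_finite.

End step.

Fixpoint lebesgue_rV n : {sigma_finite_measure set 'rV[R]_n -> \bar R} :=
  if n is m.+1 then lebesgue_rV_step (lebesgue_rV m) else \d_(0%R : 'rV[R]_0).

End lebesgue_rV.

Definition dotr (R : realType) n (u v : 'rV[R]_n) : R := (u *m v^T) 0 0.

Definition enorm (R : realType) n (u : 'rV[R]_n) : R := Num.sqrt (dotr u u).

Definition lincomb (R : realType) d k (w : d.-tuple 'rV[R]_k) (a : 'rV[R]_d) :
  'rV[R]_k := \sum_(i < d) a 0 i *: w`_i.

Lemma measurable_lincomb (R : realType) d k (w : d.-tuple 'rV[R]_k) :
  measurable_fun setT (lincomb w).
Proof.
apply/measurable_fun_rVP => j.
rewrite (_ : _ \o _ = fun a => \sum_(i < d) (w`_i 0 j * rV_coord i a)).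
  apply: measurable_sum => i; apply: measurable_funM => //.
  exact: measurable_rV_coord.
apply/funext => a; rewrite /= /rV_coord /lincomb summxE.
by apply: eq_bigr => i _; rewrite mxE mulrC.
Qed.

(* Lebesgue measure on V = span w, for w linearly independent, seen as a measure
   on R^k concentrated on V.  The square root of the Gram determinant is the
   d-volume of the parallelotope spanned by w, so that this is the measure
   induced by the Euclidean structure of V (unit cubes of V have measure 1); it
   depends on V only. *)
Section lebesgue_span.
Variables (R : realType) (d k : nat) (w : d.-tuple 'rV[R]_k).

Definition gram : 'M[R]_d := \matrix_(i, j) dotr w`_i w`_j.

Definition lebesgue_span : set 'rV[R]_k -> \bar R :=
  pushforward (mscale (Num.sqrt (\det gram))%:nng (lebesgue_rV d)) (lincomb w).

Let span0 : lebesgue_span set0 = 0%E.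
Proof. by rewrite /lebesgue_span /pushforward preimage_set0 measure0. Qed.

Let span_ge0 A : (0 <= lebesgue_span A)%E.
Proof. by rewrite /lebesgue_span /pushforward; exact: measure_ge0. Qed.

Let span_sigma_additive : semi_sigma_additive lebesgue_span.
Proof.
apply: (measure_semi_sigma_additive (s := pushforward _ _)).
exact: measurable_lincomb.
Qed.

HB.instance Definition _ := isMeasure.Build _ _ _ lebesgue_span
  span0 span_ge0 span_sigma_additive.

End lebesgue_span.

Section torus.
Variables (R : realType) (k : nat).

Definition int_lattice : {pred 'rV[R]_k} := mxOver Num.int.

Fact int_lattice_zmod_closed : zmod_closed int_lattice.
Proof.
split=> [|x y /mxOverP Zx /mxOverP Zy]; apply/mxOverP => i j; rewrite !mxE.
  exact: rpred0.
by rewrite rpredB ?Zx ?Zy.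
Qed.

HB.instance Definition _ :=
  GRing.isZmodClosed.Build 'rV[R]_k int_lattice int_lattice_zmod_closed.

Definition torus : Type := Quotient.quot int_lattice.

Definition torus_pi (x : 'rV[R]_k) : torus :=
  (\pi_(Quotient.quot int_lattice) x)%qT.

(* Lebesgue measure on the torus, computed on the fundamental domain [0, 1)^k. *)
Definition lebesgue_torus (U : set torus) : \bar R :=
  lebesgue_rV k
    ([set x : 'rV[R]_k | forall i, 0 <= x 0 i < 1] `&` torus_pi @^-1` U).

End torus.

Section strongly_diophantine.
Local Open Scope ereal_scope.
Variables (R : realType) (k : nat).

(* The inverse of [\bar R] satisfies [0^-1 = +oo], as in the convention
   1/0 = oo. *)
Definition r_basis (t : k.-tuple 'rV[R]_k) (m : 'rV[R]_k) : \bar R :=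
  \prod_(i < k) Order.min 1 (`|dotr t`_i m|%:E)^-1.

Definition int_vec (m : 'rV[int]_k) : 'rV[R]_k := map_mx intr m.

(* [`|int_vec m|] is the sup norm.  If [m.w_i = 0] for some nonzero integer
   vector [m] then the sum is +oo as soon as [`|m| <= M], and the condition
   fails. *)
Definition strongly_diophantine d (w : d.-tuple 'rV[R]_k)
    (t : k.-tuple 'rV[R]_k) : Prop :=
  forall eps : R, (0 < eps)%R -> exists2 C : R, (0 < C)%R &
    forall M : R, (0 < M)%R ->
    \esum_(m in [set m : 'rV[int]_k | m <> 0%R /\ (`|int_vec m| <= M)%R])
      (r_basis t (int_vec m) *
       \prod_(i < d) (`|dotr (int_vec m) w`_i|%:E)^-1)
    <= (C * M `^ eps)%:E.

End strongly_diophantine.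

Section discrepancy.
Variables (R : realType) (k : nat).

Definition span_box d (w : d.-tuple 'rV[R]_k) (T : R) : set 'rV[R]_k :=
  lincomb w @` [set a : 'rV[R]_d | forall i, `|a 0 i| <= T].

Definition visits d (w : d.-tuple 'rV[R]_k) (T : R) (U : set (torus R k))
    (x : 'rV[R]_k) : \bar R :=
  (\int[lebesgue_span w]_(t in span_box w T) (\1_U (torus_pi (x + t)))%:E)%E.

Definition parallelotope (t : k.-tuple 'rV[R]_k) (b : 'rV[R]_k) :
    set 'rV[R]_k :=
  lincomb t @` [set a : 'rV[R]_k | forall i, 0 <= a 0 i <= b 0 i].

(* [U] is a parallelotope of the torus aligned with [t], with sides the vectors
   [b_i t_i]. *)
Definition aligned_parallelotope (t : k.-tuple 'rV[R]_k) (b : 'rV[R]_k)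
    (U : set (torus R k)) : Prop :=
  (forall i, 0 < b 0 i) /\
  exists y : 'rV[R]_k,
    let P := [set u + y | u in parallelotope t b] in
    set_inj P (@torus_pi R k) /\ U = @torus_pi R k @` P.

End discrepancy.

(* Main.v *)
Require Import Defs.
From HB Require Import structures.
From mathcomp Require Import all_boot all_order all_algebra.
From mathcomp Require Import all_classical all_reals all_analysis.
From mathcomp Require Import measurable_realfun ring lra zify.

Set Implicit Arguments.
Unset Strict Implicit.
Unset Printing Implicit Defensive.

Import Order.TTheory GRing.Theory Num.Theory.
Import numFieldNormedType.Exports.

Local Open Scope classical_set_scope.
Local Open Scope ring_scope.

(* Let F be the N-th Fejer kernel of the torus, a nonnegative trigonometric polynomial
   of mean 1 whose mass outside the rho-neighbourhood of 0 is O(1 / (N rho^2)).  Enlarging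
   or shrinking U by O(rho) and convolving with F bounds the indicator of U from above and
   from below, up to the mass of that tail.  Along the linear flow the smoothed indicators
   are finite trigonometric sums: the zero frequency yields the volumes, and a frequency
   m <> 0 contributes at most
   prod_i (1 + b_i) min(1, 1 / |m.v_i|) prod_(i <= d) 1 / |m.v_i|, so that the strong
   Diophantine condition with M = N bounds the rest by C (1 + eta)^k N^eps.
   Finally rho is of order T^(-d) and N of order T^(3 d).

   Jacobians are never computed: the volume of the parallelotope enters |U| and the zero
   frequency through the same constant c. *)

(** * Lebesgue measure on Euclidean space *)

(** The hypothesis controls sums over bounded frequencies only, by a bound that grows with the
    cutoff, so the Fourier series of an indicator cannot be summed directly. The frequencies must be
    cut off while keeping inequalities in both directions; a nonnegative kernel does this, since
    positivity lets one kernel serve for the majorant and the minorant.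

    The exponents balance three errors along a box of volume of order T^d. Moving the faces by
    O(rho) costs O(rho T^d), bounded for rho = T^(-d) / 4. The tail of the kernel costs O(T^d / (N
    rho^2)), bounded once N >= T^(3 d). The nonzero frequencies cost N^eps, which is O(T^delta) for
    eps = delta / (3 d). As eps is arbitrary, any N polynomial in T is affordable, and so the crude
    second-moment tail of the Fejer kernel suffices. *)

Lemma ge0_integral_rV_cons (R : realType) n (f : 'rV[R]_n.+1 -> \bar R) :
  measurable_fun setT f -> (forall x, 0 <= f x)%E ->
  (\int[lebesgue_rV n.+1]_x f x =
   \int[@lebesgue_measure R]_t \int[lebesgue_rV n]_z f (rV_cons (t, z)))%E.
Proof.
move=> mf f0.
rewrite [LHS](ge0_integral_pushforward (@measurable_rV_cons R n))//.
rewrite preimage_setT (fubini_tonelli1 (f \o @rV_cons R n))//=.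
by apply: measurableT_comp => //; exact: measurable_rV_cons.
Qed.

Lemma integral_rV_cons (R : realType) n (f : 'rV[R]_n.+1 -> \bar R) :
  (lebesgue_rV n.+1).-integrable setT f ->
  (\int[lebesgue_rV n.+1]_x f x =
   \int[@lebesgue_measure R]_t \int[lebesgue_rV n]_z f (rV_cons (t, z)))%E.
Proof.
move=> intf.
have mf : measurable_fun setT f by exact: measurable_int intf.
have mfc : measurable_fun setT (f \o @rV_cons R n).
  by apply: measurableT_comp => //; exact: measurable_rV_cons.
have intfc : (@lebesgue_measure R \x lebesgue_rV n)%E.-integrable setT
    (f \o @rV_cons R n).
  apply/integrableP; split => //.
  move/integrableP : intf => [_]; apply: le_lt_trans.
  rewrite [leRHS](ge0_integral_pushforward (@measurable_rV_cons R n))//.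
  exact: measurableT_comp.
rewrite [LHS](integral_pushforward (@measurable_rV_cons R n))//.
by rewrite preimage_setT -[LHS]integral12_prod_meas1.
Qed.

Lemma measurable_rV_addr (R : realType) n (u : 'rV[R]_n) :
  measurable_fun setT (fun z : 'rV[R]_n => z + u).
Proof.
apply/measurable_fun_rVP => i.
rewrite (_ : _ \o _ = fun z => rV_coord i z + u 0 i).
  by apply: measurable_funD => //; exact: measurable_rV_coord.
by apply/funext => z; rewrite /= /rV_coord mxE.
Qed.

Lemma measurable_shift (R : realType) (a : R) :
  measurable_fun setT (fun t : measurableTypeR R => (t : R) + a : measurableTypeR R).
Proof. exact: measurable_funD. Qed.

Lemma lebesgue_measure_shift (R : realType) (a : R) (A : set (measurableTypeR R)) :
  measurable A ->
  lebesgue_measure ((fun t : R => t + a) @^-1` A) = lebesgue_measure A.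
Proof.
move=> mA; apply/esym.
pose mu : {measure set (measurableTypeR R) -> \bar R} :=
  measure_function_pushforward__canonical__measure_function_Measure
     (@lebesgue_measure R) (@measurable_shift R a).
apply: (lebesgue_measure_unique (mu := mu)) => // X [[x y] _ <-]/=.
rewrite /mu/= /pushforward/= (_ : _ @^-1` _ = `]x - a, y - a]%classic).
  rewrite !lebesgue_measure_itv/= !lte_fin ltrD2r.
  by case: ifPn => // _; rewrite -!EFinD; congr (_%:E); ring.
by apply/seteqP; split => z /=; rewrite !in_itv/= ltrBlDr lerBrDr.
Qed.

Lemma ge0_integral_shift (R : realType) (a : R) (g : measurableTypeR R -> \bar R) :
  measurable_fun setT g -> (forall x, 0 <= g x)%E ->
  (\int[@lebesgue_measure R]_t g ((t : R) + a)%R = \int[@lebesgue_measure R]_t g t)%E.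
Proof.
move=> mg g0.
pose mu : {measure set (measurableTypeR R) -> \bar R} :=
  measure_function_pushforward__canonical__measure_function_Measure
     (@lebesgue_measure R) (@measurable_shift R a).
transitivity (\int[mu]_t g t)%E.
  by rewrite (ge0_integral_pushforward (@measurable_shift R a))// preimage_setT.
by apply: eq_measure_integral => A mA _; exact: lebesgue_measure_shift.
Qed.

Lemma rV_consD (R : realType) n (t : R) (z : 'rV[R]_n) (u : 'rV[R]_n.+1) :
  rV_cons (t, z) + u =
  rV_cons (t + u 0 0, z + \row_j u 0 (lift ord0 j)).
Proof.
apply/rowP => i; rewrite !mxE.
by case: (unliftP ord0 i) => [j|] ->; rewrite ?liftK ?unlift_none/= ?mxE.
Qed.

Lemma measurable_rV_cons_section (R : realType) n (t : R) :
  measurable_fun setT (fun z : 'rV[R]_n => rV_cons (t : measurableTypeR R, z)).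
Proof.
by apply: (measurableT_comp (@measurable_rV_cons R n)); exact: measurable_pair1.
Qed.

Lemma ge0_integral_rV_addr (R : realType) n (u : 'rV[R]_n) (f : 'rV[R]_n -> \bar R) :
  measurable_fun setT f -> (forall x, 0 <= f x)%E ->
  (\int[lebesgue_rV n]_z f (z + u)%R = \int[lebesgue_rV n]_z f z)%E.
Proof.
elim: n u f => [|n IHn] u f mf f0.
  by apply: eq_integral => z _; congr f; apply/rowP => -[].
have mfu : measurable_fun setT (fun z : 'rV[R]_n.+1 => f (z + u)).
  by apply: measurableT_comp => //; exact: measurable_rV_addr.
rewrite [LHS]ge0_integral_rV_cons// [RHS]ge0_integral_rV_cons//.
rewrite -[RHS](ge0_integral_shift (u 0 0)); first last.
- by move=> t; exact: integral_ge0.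
- apply: (measurable_fun_fubini_tonelli_F (f \o @rV_cons R n)) => //.
  - by apply: measurableT_comp => //; exact: measurable_rV_cons.
  - by move=> x; exact: f0.
apply: eq_integral => t _.
under eq_integral do rewrite rV_consD.
rewrite (IHn _ (fun z => f (rV_cons ((t : R) + u 0 0, z))))//.
by apply: measurableT_comp => //; exact: measurable_rV_cons_section.
Qed.

Lemma measurable_mulmxr (R : realType) n m (W : 'M[R]_(n, m)) :
  measurable_fun setT (fun z : 'rV[R]_n => z *m W).
Proof.
apply/measurable_fun_rVP => j.
rewrite (_ : _ \o _ = fun z => \sum_i (W i j * rV_coord i z)).
  by apply: measurable_sum => i; apply: measurable_funM => //; exact: measurable_rV_coord.
by apply/funext => z; rewrite /= /rV_coord mxE; apply: eq_bigr => i _; rewrite mulrC.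
Qed.

Lemma measurable_funD_rV d (T : measurableType d) (R : realType) n
    (f g : T -> 'rV[R]_n) :
  measurable_fun setT f -> measurable_fun setT g ->
  measurable_fun setT (fun x => f x + g x).
Proof.
move=> /measurable_fun_rVP mf /measurable_fun_rVP mg.
apply/measurable_fun_rVP => i.
rewrite (_ : _ \o _ = fun x => (rV_coord i \o f) x + (rV_coord i \o g) x).
  exact: (measurable_funD (mf i) (mg i)).
by apply/funext => z; rewrite /= /rV_coord mxE.
Qed.

Lemma measurable_funN_rV d (T : measurableType d) (R : realType) n
    (f : T -> 'rV[R]_n) :
  measurable_fun setT f -> measurable_fun setT (fun x => - f x).
Proof.
move=> /measurable_fun_rVP mf; apply/measurable_fun_rVP => i.
rewrite (_ : _ \o _ = fun x => - (rV_coord i \o f) x).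
  by apply: (measurable_funN (mf i)).
by apply/funext => z; rewrite /= /rV_coord mxE.
Qed.

Definition rV_box (R : realType) n (I : 'I_n -> set R) : set 'rV[R]_n :=
  [set a | forall i, I i (a 0 i)].

Lemma measurable_rV_box (R : realType) n (I : 'I_n -> set (measurableTypeR R)) :
  (forall i, measurable (I i)) -> measurable (rV_box I).
Proof.
move=> mI; rewrite (_ : rV_box I = \bigcap_(i in [set: 'I_n]) (rV_coord i @^-1` I i)).
  apply: fin_bigcap_measurable; first exact: finite_finset.
  by move=> i _; rewrite -[X in measurable X]setTI; apply: measurable_rV_coord.
by apply/seteqP; split => a /= h i; [move=> _; exact: h|apply: h].
Qed.

Lemma rV_box_cons (R : realType) n (I : 'I_n.+1 -> set R) t z :
  rV_box I (rV_cons (t, z)) =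
  (I 0 t /\ rV_box (fun i => I (lift ord0 i)) z).
Proof.
apply/propext; split => [h|[h0 h] i].
  split; first by have := h 0; rewrite mxE unlift_none.
  by move=> i; have := h (lift ord0 i); rewrite mxE liftK.
by rewrite mxE; case: unliftP => [j|] ->.
Qed.

Lemma lebesgue_rV_box (R : realType) n (I : 'I_n -> set (measurableTypeR R)) :
  (forall i, measurable (I i)) ->
  (lebesgue_rV n (rV_box I) = \prod_i lebesgue_measure (I i))%E.
Proof.
elim: n I => [|n IHn] I mI.
  by rewrite big_ord0/= diracE mem_set// => -[].
have mI' i : measurable (I (lift ord0 i)) by [].
rewrite /= /lebesgue_rV_step /pushforward big_ord_recl -IHn//.
rewrite (_ : _ @^-1` _ = I 0 `*` rV_box (fun i => I (lift ord0 i))).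
  by rewrite product_measure1E//; exact: measurable_rV_box.
by apply/seteqP; split=> -[t z]/=; rewrite rV_box_cons.
Qed.

Definition unit_cube (R : realType) n : set 'rV[R]_n :=
  rV_box (fun=> [set t : R | 0 <= t < 1]).

Lemma measurable_unit_cube (R : realType) n : measurable (@unit_cube R n).
Proof.
apply: measurable_rV_box => _.
rewrite (_ : [set _ | _] = `[(0:R), 1[%classic); first exact: measurable_itv.
by apply/seteqP; split => t /=; rewrite in_itv.
Qed.

Lemma lebesgue_unit_cube (R : realType) n : lebesgue_rV n (@unit_cube R n) = 1%E.
Proof.
have E : [set t : R | 0 <= t < 1] = `[(0:R), 1[%classic.
  by apply/seteqP; split => t /=; rewrite in_itv.
rewrite lebesgue_rV_box => [|i]; last by rewrite E; exact: measurable_itv.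
by rewrite big1// => i _; rewrite E lebesgue_measure_itv/= lte_fin ltr01 oppr0 adde0.
Qed.

Lemma measurable_indicE (R : realType) d (T : measurableType d) (A : set T) :
  measurable A -> measurable_fun setT (fun x => (\1_A x)%:E : \bar R).
Proof. by move=> mA; apply/measurable_EFinP; exact: measurable_indic. Qed.

Lemma indicE_ge0 (R : realType) T (A : set T) x : (0 <= (\1_A x)%:E :> \bar R)%E.
Proof. by rewrite lee_fin indicE ler0n. Qed.

Lemma integral_unit_cube (R : realType) n :
  (\int[lebesgue_rV n]_x (\1_(@unit_cube R n) x)%:E = 1)%E.
Proof.
rewrite integral_indic ?setIT//; last exact: measurable_unit_cube.
exact: lebesgue_unit_cube.
Qed.

(* Weil's uniqueness argument for invariant measures: integrate
   [h (x + a W) 1_E a] over [x] and [a], with [E] the unit cube, in both orders. *)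
Lemma ge0_integral_rV_mulmx (R : realType) n (W : 'M[R]_n) :
  W \in unitmx ->
  exists2 c : R, 0 <= c & forall h : 'rV[R]_n -> \bar R,
    measurable_fun setT h -> (forall x, 0 <= h x)%E ->
    (\int[lebesgue_rV n]_x h x =
     c%:E * \int[lebesgue_rV n]_a h (a *m W)%R)%E.
Proof.
move=> Wu; pose E := @unit_cube R n.
pose e (x : 'rV[R]_n) : \bar R := (\1_E x)%:E.
have me : measurable_fun setT e by apply: measurable_indicE; exact: measurable_unit_cube.
have e0 x : (0 <= e x)%E by exact: indicE_ge0.
have mW V : measurable_fun setT (fun z : 'rV[R]_n => z *m V) by exact: measurable_mulmxr.
pose c := (\int[lebesgue_rV n]_x e (- (x *m invmx W))%R)%E.
have key (h : 'rV[R]_n -> \bar R) : measurable_fun setT h -> (forall x, 0 <= h x)%E ->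
    (\int[lebesgue_rV n]_x h x = c * \int[lebesgue_rV n]_a h (a *m W)%R)%E.
  move=> mh h0.
  have mhW : measurable_fun setT (fun a => h (a *m W)) by exact: (measurableT_comp mh (mW _ W)).
  have m1 : measurable_fun setT (fun p : 'rV[R]_n * 'rV[R]_n => (h (p.1 + p.2 *m W)%R * e p.2)%E).
    apply: emeasurable_funM; last exact: (measurableT_comp me measurable_snd).
    apply: (measurableT_comp mh); apply: measurable_funD_rV; first exact: measurable_fst.
    exact: (measurableT_comp (mW _ W) measurable_snd).
  (* With [x] integrated first, translation by [a *m W] leaves the integral of [h] unchanged, and
     the remaining factor [e a] integrates to 1. *)
  transitivity (\int[lebesgue_rV n]_x \int[lebesgue_rV n]_a (h (x + a *m W)%R * e a))%E.
    rewrite (fubini_tonelli (fun p : 'rV[R]_n * 'rV[R]_n =>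
      (h (p.1 + p.2 *m W)%R * e p.2)%E))//=; last first.
      by move=> p; rewrite mule_ge0.
    transitivity (\int[lebesgue_rV n]_a (e a * \int[lebesgue_rV n]_x h x))%E.
      rewrite ge0_integralZr//; last by apply: integral_ge0.
      by rewrite integral_unit_cube mul1e.
    apply: eq_integral => a _; rewrite ge0_integralZr//; last first.
      by apply: (measurableT_comp mh); exact: measurable_rV_addr.
    by rewrite muleC ge0_integral_rV_addr.
  (* Shifting [a] by [- (x *m invmx W)] frees [h] of [x]. What remains then integrates over [x] to
     [c] for every [a], by a shift of [x] by [a *m W]. *)
  transitivity (\int[lebesgue_rV n]_x \int[lebesgue_rV n]_a
      (h (a *m W)%R * e (a - x *m invmx W)%R))%E.
    apply: eq_integral => x _.
    rewrite -[LHS](ge0_integral_rV_addr (- (x *m invmx W)))//.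
    - by apply: eq_integral => a _; rewrite mulmxDl mulNmx mulmxKV// addrC subrK.
    - exact: (measurableT_comp m1 (measurable_pair1 x)).
    - by move=> a; rewrite mule_ge0.
  have m2 : measurable_fun setT (fun p : 'rV[R]_n * 'rV[R]_n =>
      (h (p.2 *m W)%R * e (p.2 - p.1 *m invmx W)%R)%E).
    apply: emeasurable_funM; first exact: (measurableT_comp mhW measurable_snd).
    apply: (measurableT_comp me); apply: measurable_funD_rV; first exact: measurable_snd.
    exact: (measurable_funN_rV (measurableT_comp (mW _ _) measurable_fst)).
  rewrite (fubini_tonelli (fun p : 'rV[R]_n * 'rV[R]_n =>
    (h (p.2 *m W)%R * e (p.2 - p.1 *m invmx W)%R)%E))//=; last first.
    by move=> p; rewrite mule_ge0.
  rewrite -ge0_integralZl//; last by apply: integral_ge0.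
  apply: eq_integral => a _; rewrite ge0_integralZl//; last first.
    apply: (measurableT_comp me); apply: measurable_funD_rV => //.
    by apply: measurable_funN_rV.
  rewrite muleC; congr (_ * _)%E.
  rewrite -[LHS](ge0_integral_rV_addr (a *m W))//.
    by apply: eq_integral => x _; rewrite mulmxDl mulmxK// opprD addrCA subrr addr0.
  apply: (measurableT_comp me); apply: measurable_funD_rV => //.
  by apply: measurable_funN_rV.
have c0 : (0 <= c)%E by exact: integral_ge0.
(* The identity for [e] itself reads 1 = [c] times a nonnegative integral, which excludes
   [c = +oo]. *)
have cfin : c \is a fin_num.
  have := key e me e0; rewrite integral_unit_cube.
  move: c0; case: (c) => [//| |//] _.
  set X := (X in (+oo * X)%E); have : (0 <= X)%E by exact: integral_ge0.
  rewrite le_eqVlt => /orP[/eqP<-|X0]; first by rewrite mule0 => /eqP; rewrite onee_eq0.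
  by rewrite gt0_mulye.
exists (fine c); first exact: fine_ge0.
by move=> h mh h0; rewrite key// fineK.
Qed.

(** * Unfolding over the integer lattice *)

Definition rV_floor (R : realType) n (z : 'rV[R]_n) : 'rV[int]_n := \row_i Num.floor (z 0 i).

Lemma unit_cube_floor (R : realType) n (z : 'rV[R]_n) (m : 'rV[int]_n) :
  @unit_cube R n (z - int_vec R m) <-> m = rV_floor z.
Proof.
split=> [h|-> i].
  apply/rowP => i; have := h i; rewrite /= /int_vec !mxE => /andP[h1 h2].
  by apply/esym/floor_def; rewrite intrD; apply/andP; split; lra.
rewrite /= /int_vec !mxE; have /andP[] := floor_itv (z 0 i); rewrite intrD => h1 h2.
by apply/andP; split; lra.
Qed.

Lemma measurable_translate (R : realType) n (u : 'rV[R]_n) (A : set 'rV[R]_n) :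
  measurable A -> measurable [set z | A (z + u)].
Proof.
by move=> mA; rewrite -[X in measurable X]setTI; exact: (measurable_rV_addr u).
Qed.

(* The sum of [h (q + m)] over the integer lattice, enumerated by [pickle_inv]. *)
Definition lattice_sum (R : realType) n (h : 'rV[R]_n -> \bar R) (q : 'rV[R]_n) : \bar R :=
  (\sum_(i <oo) oapp (fun m : 'rV[int]_n => h (q + int_vec R m)%R) 0 (pickle_inv i))%E.

Lemma measurable_lattice_sum (R : realType) n (h : 'rV[R]_n -> \bar R) :
  measurable_fun setT h -> (forall x, 0 <= h x)%E ->
  measurable_fun setT (lattice_sum h).
Proof.
move=> mh h0; apply: ge0_emeasurable_sum => [i x _ _|i _].
  by case: pickle_inv => //= m; exact: h0.
case: pickle_inv => [m|] /=; last exact: measurable_cst.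
by apply: (measurableT_comp mh); exact: measurable_rV_addr.
Qed.

(** The integer translates of the half-open cube partition space, and translation invariance moves
    the integral over each of them back to the cube. *)
Lemma ge0_integral_unfold (R : realType) n (h : 'rV[R]_n -> \bar R) :
  measurable_fun setT h -> (forall x, 0 <= h x)%E ->
  (\int[lebesgue_rV n]_x h x = \int[lebesgue_rV n]_(q in @unit_cube R n) lattice_sum h q)%E.
Proof.
move=> mh h0.
pose F (i : nat) : set 'rV[R]_n :=
  oapp (fun m : 'rV[int]_n => [set z | @unit_cube R n (z - int_vec R m)]) set0 (pickle_inv i).
have mF i : measurable (F i).
  rewrite /F; case: pickle_inv => [m|] //=.
  by apply: measurable_translate; exact: measurable_unit_cube.
have UF : \bigcup_i F i = setT.
  apply/seteqP; split => // z _; exists (pickle (rV_floor z)) => //.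
  by rewrite /F pickleK_inv /=; apply/unit_cube_floor.
rewrite -UF ge0_integral_bigcup//; last 2 first.
- exact: measurable_funTS.
- apply/trivIsetP => i j _ _ ij; apply/seteqP; split => // z []; rewrite /F.
  have := @pickle_invK 'rV[int]_n i; have := @pickle_invK 'rV[int]_n j.
  case: pickle_inv => [m|] //=; case: pickle_inv => [m'|] //= jE iE.
  move=> /unit_cube_floor mE /unit_cube_floor m'E.
  by move: ij; rewrite -iE -jE mE m'E eqxx.
rewrite integral_nneseries//; first last.
- by move=> i q _; case: pickle_inv => //= m; exact: h0.
- move=> i; case: pickle_inv => [m|] /=; last exact: measurable_cst.
  by apply: measurable_funTS; apply: (measurableT_comp mh); exact: measurable_rV_addr.
- exact: measurable_unit_cube.
apply: eq_eseriesr => i _; rewrite /F; case: pickle_inv => [m|] /=; last first.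
  by rewrite integral_set0 integral0.
rewrite integral_mkcond [RHS]integral_mkcond.
have mC : measurable_fun setT (h \_ [set z | @unit_cube R n (z - int_vec R m)]).
  apply/(measurable_restrictT h).
    by apply: measurable_translate; exact: measurable_unit_cube.
  exact: measurable_funTS.
rewrite -[LHS](ge0_integral_rV_addr (int_vec R m))//; last first.
  by move=> z; rewrite patchE; case: ifP.
apply: eq_integral => z _; rewrite !patchE; congr (if _ then _ else _).
by apply/idP/idP; rewrite !inE /= addrK.
Qed.

(** * The torus *)

Lemma torus_piP (R : realType) n (x y : 'rV[R]_n) :
  torus_pi x = torus_pi y <-> exists m : 'rV[int]_n, y = x + int_vec R m.
Proof.
rewrite /torus_pi; split=> [/eqP|[m ->]].
  rewrite -Quotient.idealrBE => /mxOverP xy.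
  exists (- \row_i Num.floor ((x - y) 0 i)); apply/rowP => i.
  have := floorK (xy 0 i); rewrite /int_vec !mxE rmorphN/= => ->.
  ring.
apply/eqP; rewrite -Quotient.idealrBE opprD addNKr; apply/mxOverP => i j.
by rewrite /int_vec !mxE rpredN intr_int.
Qed.

Lemma int_vecD (R : realType) n (m m' : 'rV[int]_n) :
  int_vec R (m + m') = int_vec R m + int_vec R m'.
Proof. by apply/rowP => i; rewrite /int_vec !mxE intrD. Qed.

Lemma torus_pi_addr (R : realType) n (x : 'rV[R]_n) m :
  torus_pi (x + int_vec R m) = torus_pi x.
Proof. by apply/esym/torus_piP; exists m. Qed.

Lemma lattice_sum_term_le (R : realType) n (h : 'rV[R]_n -> \bar R) q m :
  (forall x, 0 <= h x)%E -> (h (q + int_vec R m)%R <= lattice_sum h q)%E.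
Proof.
move=> h0; rewrite /lattice_sum (@nneseriesD1 _ _ (pickle m))//; last first.
  by move=> i _; case: pickle_inv => //= m'; exact: h0.
rewrite pickleK_inv /= leeDl//; apply: nneseries_ge0 => i _ _.
by case: pickle_inv => //= m'; exact: h0.
Qed.

(** Two nonzero terms would be two points of [A] with the same projection. Injectivity thus leaves
    at most one, and the sum does not count multiplicities. *)
Lemma lattice_sum_indic (R : realType) n (A : set 'rV[R]_n) q :
  set_inj A (@torus_pi R n) ->
  lattice_sum (fun x => (\1_A x)%:E) q =
  (\1_(@torus_pi R n @` A) (torus_pi q))%:E.
Proof.
move=> injA.
have h0 x : (0 <= (\1_A x)%:E :> \bar R)%E by exact: indicE_ge0.
case: (pselect (exists m, A (q + int_vec R m))) => [[m Am]|nA]; last first.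
  rewrite [in RHS]indicE memNset; last first.
    move=> [x Ax /esym /torus_piP[m xE]]; apply: nA; exists m.
    by rewrite -xE.
  rewrite /lattice_sum eseries0// => i _ _; case: pickle_inv => //= m.
  by rewrite indicE memNset// => Am; apply: nA; exists m.
rewrite [in RHS]indicE mem_set; last first.
  by exists (q + int_vec R m) => //; rewrite torus_pi_addr.
rewrite /lattice_sum (@nneseriesD1 _ _ (pickle m))//; last first.
  by move=> i _; case: pickle_inv => //= m'; exact: h0.
rewrite pickleK_inv /= indicE mem_set// eseries0 ?adde0// => i _ /= im.
have := @pickle_invK 'rV[int]_n i.
case: pickle_inv => //= m' m'E; rewrite indicE memNset// => Am'.
move: im; rewrite -m'E (_ : m' = m) ?eqxx//.
have /addrI : q + int_vec R m' = q + int_vec R m.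
  by apply: injA; rewrite ?inE// !torus_pi_addr.
rewrite /int_vec => /(congr1 (map_mx Num.floor)) /rowP E; apply/rowP => j.
by have := E j; rewrite !mxE !intrKfloor.
Qed.

Lemma measurable_torus_pi_preimage (R : realType) n (A : set 'rV[R]_n) :
  measurable A -> measurable (@torus_pi R n @^-1` (@torus_pi R n @` A)).
Proof.
move=> mA.
rewrite (_ : _ @^-1` _ = \bigcup_i
    oapp (fun m : 'rV[int]_n => [set q | A (q + int_vec R m)]) set0 (pickle_inv i)).
  apply: bigcup_measurable => i _; case: pickle_inv => [m|] //=.
  exact: measurable_translate.
apply/seteqP; split => q /=.
  move=> [x Ax /esym /torus_piP[m xE]]; exists (pickle m) => //.
  by rewrite pickleK_inv /= -xE.
move=> [i _]; case: pickle_inv => //= m Am.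
by exists (q + int_vec R m) => //; rewrite torus_pi_addr.
Qed.

(** [lebesgue_torus] only sees the unit cube, whereas [A] may spread over many cubes; unfolding
    brings its pieces together, and injectivity keeps them disjoint. *)
Lemma lebesgue_torus_image (R : realType) n (A : set 'rV[R]_n) :
  measurable A -> set_inj A (@torus_pi R n) ->
  lebesgue_torus (@torus_pi R n @` A) = lebesgue_rV n A.
Proof.
move=> mA injA.
have <- : (\int[lebesgue_rV n]_x (\1_A x)%:E)%E = lebesgue_rV n A.
  by rewrite integral_indic// setIT.
rewrite ge0_integral_unfold; first last.
- by move=> x; exact: indicE_ge0.
- exact: measurable_indicE.
transitivity (\int[lebesgue_rV n]_(q in @unit_cube R n)
   (\1_(@torus_pi R n @^-1` (@torus_pi R n @` A)) q)%:E)%E.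
  rewrite integral_indic//; last 2 first.
  - exact: measurable_unit_cube.
  - exact: measurable_torus_pi_preimage.
  by rewrite setIC.
by apply: eq_integral => q _; rewrite lattice_sum_indic// !indicE.
Qed.

(** * Smoothed indicators on the torus *)

Section smoothing.
Variables (R : realType) (n : nat) (F : 'rV[R]_n -> R).
Hypotheses (mF : measurable_fun setT F) (F0 : forall z, 0 <= F z)
  (Fper : forall z (m : 'rV[int]_n), F (z + int_vec R m) = F z).

(** For periodic [F] this is the correlation on the torus of [F] with the periodized indicator of
    [A]. Written over all of space it needs no lattice sum, so that for a box [A] it splits into
    one-dimensional integrals. *)
Definition smooth_indic (A : set 'rV[R]_n) (z : 'rV[R]_n) : \bar R :=
  (\int[lebesgue_rV n]_p ((F (p - z))%:E * (\1_A p)%:E))%E.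

Lemma smooth_indicE A z : measurable A ->
  (smooth_indic A z = \int[lebesgue_rV n]_(q in @unit_cube R n)
    ((F q)%:E * lattice_sum (fun p : 'rV[R]_n => (\1_A (p + z)%R)%:E) q))%E.
Proof.
move=> mA.
have mFE : measurable_fun setT (fun z => (F z)%:E) by exact/measurable_EFinP.
have m1 : measurable_fun setT (fun p : 'rV[R]_n => ((F (p - z))%:E * (\1_A p)%:E)%E).
  apply: emeasurable_funM; last exact: measurable_indicE.
  exact: (measurableT_comp mFE (measurable_rV_addr (- z))).
rewrite /smooth_indic -[LHS](ge0_integral_rV_addr z)//; last first.
  by move=> p; rewrite mule_ge0 ?lee_fin ?F0.
under eq_integral do rewrite addrK.
rewrite ge0_integral_unfold; first last.
- by move=> p; rewrite mule_ge0 ?lee_fin ?F0.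
- apply: emeasurable_funM => //.
  exact: (measurableT_comp (@measurable_indicE R _ _ A mA) (measurable_rV_addr z)).
apply: eq_integral => q _; rewrite /lattice_sum -nneseriesZl; last first.
  by move=> i _; case: pickle_inv => //= m; exact: indicE_ge0.
apply: eq_eseriesr => i _; case: pickle_inv => [m|] /=; last by rewrite mule0.
by rewrite Fper.
Qed.

Variables (N : set 'rV[R]_n) (tau : R).
Hypotheses (mN : measurable N)
  (F1 : (\int[lebesgue_rV n]_(q in @unit_cube R n) (F q)%:E = 1)%E)
  (Ftail : (\int[lebesgue_rV n]_(q in @unit_cube R n)
      ((F q)%:E * (\1_(~` N) q)%:E) <= tau%:E)%E).

Let mFE : measurable_fun setT (fun z => (F z)%:E).
Proof. exact/measurable_EFinP. Qed.

Let tau0 : 0 <= tau.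
Proof.
rewrite -lee_fin; apply: le_trans Ftail; apply: integral_ge0 => q _.
by rewrite mule_ge0 ?lee_fin ?F0 ?indicE.
Qed.

Let mC : measurable (@unit_cube R n) := @measurable_unit_cube R n.

Let mtail : measurable_fun setT (fun q => ((F q)%:E * (\1_(~` N) q)%:E)%E).
Proof.
by apply: emeasurable_funM => //; apply: measurable_indicE; exact: measurableC.
Qed.

Let mA_ls (A : set 'rV[R]_n) (z : 'rV[R]_n) : measurable A ->
  measurable_fun setT (fun q =>
    ((F q)%:E * lattice_sum (fun p : 'rV[R]_n => (\1_A (p + z)%R)%:E) q)%E).
Proof.
move=> mA; apply: emeasurable_funM => //; apply: measurable_lattice_sum.
  exact: (measurableT_comp (@measurable_indicE R _ _ A mA) (measurable_rV_addr z)).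
by move=> x; exact: indicE_ge0.
Qed.

Let ls_ge0 (A : set 'rV[R]_n) (z q : 'rV[R]_n) :
  (0 <= lattice_sum (fun p : 'rV[R]_n => (\1_A (p + z)%R)%:E) q :> \bar R)%E.
Proof. by apply: nneseries_ge0 => i _ _; case: pickle_inv => //= m; exact: indicE_ge0. Qed.

(** If [z] projects into the image of [A], every [q] in [N] contributes a lattice sum at least 1, so
    the smoothed value is at least the mass of [F] on [N], which is at least [1 - tau]. Overlapping
    translates of [A1] only help, hence no injectivity is assumed here. *)
Lemma indic_le_smooth (A A1 : set 'rV[R]_n) (z : 'rV[R]_n) : measurable A1 ->
  (forall p q, A p -> N q -> exists m : 'rV[int]_n, A1 (p + q + int_vec R m)) ->
  ((\1_(@torus_pi R n @` A) (torus_pi z))%:E <= smooth_indic A1 z + tau%:E)%E.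
Proof.
move=> mA1 AA1; rewrite smooth_indicE//.
have I0 : (0 <= \int[lebesgue_rV n]_(q in @unit_cube R n)
    ((F q)%:E * lattice_sum (fun p : 'rV[R]_n => (\1_A1 (p + z)%R)%:E) q))%E.
  by apply: integral_ge0 => q _; rewrite mule_ge0// lee_fin.
rewrite indicE; have [/set_mem|_] := boolP (torus_pi z \in @torus_pi R n @` A); last first.
  by rewrite adde_ge0// lee_fin.
move=> [p0 Ap0 /esym /torus_piP[m0 p0E]].
apply: (@le_trans _ _ (\int[lebesgue_rV n]_(q in @unit_cube R n)
    ((F q)%:E * lattice_sum (fun p : 'rV[R]_n => (\1_A1 (p + z)%R)%:E) q) +
    \int[lebesgue_rV n]_(q in @unit_cube R n)
      ((F q)%:E * (\1_(~` N) q)%:E))%E); last by rewrite leeD2l.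
rewrite -ge0_integralD//; last 4 first.
- by move=> q _; rewrite mule_ge0// lee_fin.
- exact: measurable_funTS (mA_ls _ _).
- by move=> q _; rewrite mule_ge0// lee_fin.
- exact: measurable_funTS.
rewrite -F1; apply: ge0_le_integral => //.
- by move=> q _; rewrite lee_fin.
- exact: measurable_funTS.
- by apply: measurable_funTS; apply: emeasurable_funD => //; exact: mA_ls.
move=> q _; case: (pselect (N q)) => [Nq|nNq]; last first.
  by rewrite (@indicE _ _ (~` N) q) mem_set// mule1 leeDr// mule_ge0// lee_fin.
have [m1 A1m1] := AA1 _ _ Ap0 Nq.
apply: (@le_trans _ _
  ((F q)%:E * lattice_sum (fun p : 'rV[R]_n => (\1_A1 (p + z)%R)%:E) q)%E); last first.
  by rewrite leeDl// mule_ge0 ?lee_fin ?F0.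
rewrite -[leLHS]mule1 lee_wpmul2l ?lee_fin ?F0//.
apply: le_trans (lattice_sum_term_le q (m0 + m1) _); last first.
  by move=> x; exact: indicE_ge0.
rewrite indicE mem_set//; move: A1m1; congr A1.
by rewrite p0E int_vecD; apply/rowP => i; rewrite !mxE; ring.
Qed.

(** Outside the image of [A] only the [q] off [N] contribute, so the tail bounds the value. Inside,
    the bound 1 requires that the translates of [A1] do not overlap, which is where injectivity
    enters. *)
Lemma smooth_le_indic (A A1 : set 'rV[R]_n) (z : 'rV[R]_n) :
  measurable A1 -> set_inj A1 (@torus_pi R n) ->
  (forall p q, A1 p -> N q -> exists m : 'rV[int]_n, A (p - q + int_vec R m)) ->
  (smooth_indic A1 z <= (\1_(@torus_pi R n @` A) (torus_pi z))%:E + tau%:E)%E.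
Proof.
move=> mA1 injA1 A1A; rewrite smooth_indicE//.
have ls1 q : (lattice_sum (fun p : 'rV[R]_n => (\1_A1 (p + z)%R)%:E) q <= 1 :> \bar R)%E.
  rewrite (@lattice_sum_indic _ _ [set p | A1 (p + z)]).
    by rewrite lee_fin indicE lern1 leq_b1.
  move=> p p' /[!inE] A1p A1p' /torus_piP[m p'E].
  apply: (addIr z); apply: injA1; rewrite ?inE//.
  by apply/torus_piP; exists m; rewrite p'E addrAC.
rewrite indicE; have [_|] := boolP (torus_pi z \in @torus_pi R n @` A).
  apply: (@le_trans _ _ 1%E); last by rewrite leeDl// lee_fin.
  rewrite -F1; apply: ge0_le_integral => //.
  - by move=> q _; rewrite mule_ge0// lee_fin.
  - exact: measurable_funTS (mA_ls _ _).
  - exact: measurable_funTS.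
  - by move=> q _; rewrite -[leRHS]mule1 lee_wpmul2l ?lee_fin.
rewrite notin_setE => nU; rewrite add0e; apply: le_trans Ftail; apply: ge0_le_integral => //.
- by move=> q _; rewrite mule_ge0// lee_fin.
- exact: measurable_funTS (mA_ls _ _).
- exact: measurable_funTS.
move=> q _; rewrite lee_wpmul2l ?lee_fin//.
case: (pselect (N q)) => [Nq|nNq]; last by rewrite (@indicE _ _ (~` N) q) mem_set.
rewrite (@indicE _ _ (~` N) q) memNset; last by move=> /(_ Nq).
rewrite /lattice_sum eseries0// => i _ _; case: pickle_inv => //= m.
rewrite indicE memNset// => A1p; apply: nU.
have [m' Am'] := A1A _ _ A1p Nq.
exists (q + int_vec R m + z - q + int_vec R m') => //.
rewrite torus_pi_addr (_ : _ + _ + _ - _ = z + int_vec R m) ?torus_pi_addr//.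
by rewrite addrAC (addrC q) addrK addrC.
Qed.

End smoothing.

(** * Integrals of trigonometric polynomials *)

Lemma measurable_cos_sum (R : realType) n (th : R) (l : 'I_n -> R) :
  measurable_fun setT (fun a : 'rV[R]_n => cos (th + \sum_i a 0 i * l i)).
Proof.
apply: measurableT_comp.
  by apply: continuous_measurable_fun; exact: continuous_cos.
apply: measurable_funD => //; apply: measurable_sum => i.
by apply: measurable_funM => //; exact: measurable_rV_coord.
Qed.

Lemma rV_box_lty (R : realType) n (I : 'I_n -> set (measurableTypeR R)) :
  (forall i, measurable (I i)) -> (forall i, lebesgue_measure (I i) < +oo)%E ->
  (lebesgue_rV n (rV_box I) < +oo)%E.
Proof.
move=> mI Ioo; rewrite lebesgue_rV_box// -ge0_fin_numE; last exact: prode_ge0.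
by apply: prode_fin_num => i _; rewrite ge0_fin_numE.
Qed.

Lemma integrable_cos_box (R : realType) n (th : R) (l : 'I_n -> R)
    (I : 'I_n -> set (measurableTypeR R)) :
  (forall i, measurable (I i)) -> (forall i, lebesgue_measure (I i) < +oo)%E ->
  (lebesgue_rV n).-integrable (rV_box I)
    (fun a => (cos (th + \sum_i a 0 i * l i))%:E).
Proof.
move=> mI Ioo; apply: measurable_bounded_integrable.
- exact: measurable_rV_box.
- exact: rV_box_lty.
- by apply: measurable_funTS; exact: measurable_cos_sum.
- exists 1; split; first exact: num_real.
  by move=> x x1 a _ /=; apply: le_trans (ltW x1); exact: cos_max.
Qed.

(** The real form of the factorization of an exponential over a box: integrating out one coordinate
    multiplies by [S i] and advances the phase by [ph i]. The phase [th] stays arbitrary so that the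
    induction can absorb the outer variable into it. *)
Lemma integral_cos_box (R : realType) n (l S ph : 'I_n -> R)
    (I : 'I_n -> set (measurableTypeR R)) :
  (forall i, measurable (I i)) -> (forall i, lebesgue_measure (I i) < +oo)%E ->
  (forall i th, \int[lebesgue_measure]_(t in I i) (cos (th + (t : R) * l i))%:E =
    (S i * cos (th + ph i))%:E)%E ->
  forall th, (\int[lebesgue_rV n]_(a in rV_box I) (cos (th + \sum_i a 0 i * l i))%:E =
    ((\prod_i S i) * cos (th + \sum_i ph i))%:E)%E.
Proof.
elim: n l S ph I => [|n IHn] l S ph I mI Ioo HI th.
  rewrite integral_dirac//; last first.
    by apply: measurable_funTS; apply/measurable_EFinP; exact: measurable_cos_sum.
    exact: (measurable_rV_box mI).
  by rewrite diracE mem_set ?mul1e ?big_ord0 ?addr0 ?mul1r// => -[].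
rewrite integral_mkcond integral_rV_cons; last first.
  by rewrite -integrable_mkcond; [exact: integrable_cos_box|exact: measurable_rV_box].
transitivity (\int[lebesgue_measure]_(t in I ord0)
   ((\prod_i S (lift ord0 i)) * cos ((th + \sum_i ph (lift ord0 i)) + (t : R) * l ord0)%R)%:E)%E.
  rewrite [RHS]integral_mkcond; apply: eq_integral => t _; rewrite [RHS]patchE.
  case: ifPn => [/set_mem It|/negP It]; last first.
    apply: integral0_eq => z _.
    rewrite patchE memNset// rV_box_cons => -[It' _].
    by apply: It; rewrite inE.
  have := IHn (fun i => l (lift ord0 i)) (fun i => S (lift ord0 i)) (fun i => ph (lift ord0 i))
    (fun i => I (lift ord0 i)) (fun i => mI _) (fun i => Ioo _) (fun i => HI _)
    (th + (t : R) * l 0).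
  rewrite [LHS]integral_mkcond (addrAC th) => <-.
  apply: eq_integral => z _; rewrite !patchE.
  have -> : (rV_cons (t, z) \in rV_box I) = (z \in rV_box (fun i => I (lift ord0 i))).
    by apply/idP/idP; rewrite !inE rV_box_cons => // -[].
  case: ifP => // _; congr (cos _)%:E.
  rewrite big_ord_recl mxE unlift_none/= addrA; congr (_ + _).
  by apply: eq_bigr => i _; rewrite mxE liftK.
under eq_integral do rewrite EFinM.
have mu1 : lebesgue_measure.-integrable (I 0) 
    (fun t => (cos ((th + \sum_i ph (lift ord0 i)) + (t : R) * l ord0)%R)%:E).
  apply: measurable_bounded_integrable; [exact: mI|exact: Ioo|..].
  - apply: measurable_funTS; apply: measurableT_comp.
      by apply: continuous_measurable_fun; exact: continuous_cos.
    by apply: measurable_funD => //; exact: measurable_funM.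
  - exists 1; split; first exact: num_real.
    by move=> x x1 a _ /=; apply: le_trans (ltW x1); exact: cos_max.
rewrite integralZl// HI -EFinM big_ord_recl [in RHS]big_ord_recl.
congr (_%:E); rewrite mulrCA mulrA; congr (_ * cos _); ring.
Qed.

(** The integral of [cos (t * l)] over [-h <= t <= h], that is, the Fourier transform of an
    interval. *)
Definition sinc_int (R : realType) (l h : R) : R :=
  if l == 0 then 2 * h else 2 * sin (l * h) / l.

Lemma integral_cos_itv (R : realType) (b0 b1 : bool) (th l c h : R) : 0 <= h ->
  (\int[lebesgue_measure]_(t in [set` Interval (BSide b0 (c - h)%R) (BSide b1 (c + h)%R)])
     (cos (th + (t : R) * l))%:E = (sinc_int l h * cos (th + c * l))%:E)%E.
Proof.
move=> h0; rewrite integral_itv_bndoo; last first.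
  apply: measurable_funTS; apply/measurable_EFinP; apply: measurableT_comp.
    by apply: continuous_measurable_fun; exact: continuous_cos.
  by apply: measurable_funD => //; exact: measurable_funM.
(* The fundamental theorem of calculus needs a nondegenerate interval; for [h = 0] both sides
   vanish. *)
move: h0; rewrite le_eqVlt => /orP[/eqP <-|h0].
  rewrite subr0 addr0 set_itvoo0 integral_set0 /sinc_int.
  by case: ifPn => _; rewrite !(mulr0, sin0, mul0r).
rewrite -(@integral_itv_bndoo _ _ _ _ true false); last first.
  apply: measurable_funTS; apply/measurable_EFinP; apply: measurableT_comp.
    by apply: continuous_measurable_fun; exact: continuous_cos.
  by apply: measurable_funD => //; exact: measurable_funM.
rewrite /sinc_int; case: ifPn => [/eqP ->|l0].
  under eq_integral do rewrite mulr0 addr0.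
  rewrite integral_cst//= lebesgue_measure_itv/= lte_fin ltrD2l gtrN//.
  by rewrite -EFinD -EFinM mulr0 addr0; congr (_%:E); ring.
pose G (t : R) := l^-1 * sin (th + t * l).
have dG (t : R) : is_derive t 1 G (cos (th + t * l)).
  rewrite /G; apply: is_derive_eq; rewrite /GRing.scale/=.
  by field.
have cG : continuous G.
  by move=> t; apply/differentiable_continuous/derivable1_diffP.
rewrite (@continuous_FTC2 _ _ G).
- rewrite -EFinB /G; congr (_%:E).
  rewrite (_ : th + (c + h) * l = (th + c * l) + l * h); last ring.
  rewrite (_ : th + (c - h) * l = (th + c * l) - l * h); last ring.
  by rewrite sinB sinD; field.
- by rewrite ltrD2l gtrN.
- apply: continuous_subspaceT => t.
  apply: continuous_comp; last exact: continuous_cos.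
  by apply: cvgD; [exact: cvg_cst|apply: cvgMl].
- split; first by [].
  + exact/cvg_at_right_filter/cG.
  + exact/cvg_at_left_filter/cG.
- by move=> t _; rewrite derive1E; exact: derive_val.
Qed.

Lemma integral_finite_lincomb (R : realType) d (T : measurableType d)
    (mu : {measure set T -> \bar R}) (D : set T) (I : finType) (a r : I -> R)
    (f : I -> T -> R) :
  measurable D ->
  (forall i, mu.-integrable D (fun x => (f i x)%:E)) ->
  (forall i, \int[mu]_(x in D) (f i x)%:E = (r i)%:E)%E ->
  (\int[mu]_(x in D) (\sum_i a i * f i x)%:E = (\sum_i a i * r i)%:E)%E.
Proof.
move=> mD intf fr; under eq_integral do rewrite -sumEFin.
rewrite integral_sum//; last by move=> i; under eq_fun do rewrite EFinM; exact: integrableZl.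
rewrite -sumEFin; apply: eq_bigr => i _; rewrite EFinM -fr -integralZl//.
Qed.

Lemma integrable_finite_lincomb (R : realType) d (T : measurableType d)
    (mu : {measure set T -> \bar R}) (D : set T) (I : finType) (a : I -> R)
    (f : I -> T -> R) :
  measurable D ->
  (forall i, mu.-integrable D (fun x => (f i x)%:E)) ->
  mu.-integrable D (fun x => (\sum_i a i * f i x)%:E).
Proof.
move=> mD intf.
rewrite (_ : (fun x => _) = fun x => (\sum_i (a i)%:E * (f i x)%:E)%E); last first.
  by apply/funext => x; rewrite -sumEFin.
by apply: integrable_sum => // i _; exact: integrableZl.
Qed.

Lemma sin_pi_int (R : realType) (m : int) : sin (pi * m%:~R) = 0 :> R.
Proof.
have sn (n : nat) : sin (pi * n%:R) = 0 :> R.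
  elim: n => [|n IHn]; first by rewrite mulr0 sin0.
  by rewrite -addn1 natrD mulrDr mulr1 sinDpi IHn oppr0.
case: m => n; first exact: sn.
by rewrite NegzE rmorphN/= mulrN sinN [X in - X](sn n.+1) oppr0.
Qed.

Lemma cos_addr_2pi_int (R : realType) (x : R) (m : int) :
  cos (x + 2 * pi * m%:~R) = cos x.
Proof.
have cn (n : nat) y : cos (y + 2 * pi * n%:R) = cos y :> R.
  rewrite (_ : 2 * pi * n%:R = (pi *+ 2) *+ n); last by rewrite -[RHS]mulr_natr -(mulr_natl pi).
  by rewrite (periodicn (@cosD2pi R)).
case: m => n; first exact: cn.
by rewrite NegzE rmorphN/= -[LHS](cn n.+1) mulrN subrK.
Qed.

(** The argument of the character of frequency [m]; characters are represented by cosines of it, so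
    that no complex numbers occur. *)
Definition phase (R : realType) k (m : 'rV[int]_k) (z : 'rV[R]_k) : R :=
  \sum_i z 0 i * (2 * pi * (m 0 i)%:~R).

Lemma phaseD (R : realType) k (m : 'rV[int]_k) (y z : 'rV[R]_k) :
  phase m (y + z) = phase m y + phase m z.
Proof. by rewrite -big_split; apply: eq_bigr => i _; rewrite mxE mulrDl. Qed.

Lemma phaseZ (R : realType) k (m : 'rV[int]_k) c (z : 'rV[R]_k) :
  phase m (c *: z) = c * phase m z.
Proof. by rewrite mulr_sumr; apply: eq_bigr => i _; rewrite mxE -!mulrA. Qed.

Lemma phaseN (R : realType) k (m : 'rV[int]_k) (z : 'rV[R]_k) :
  phase m (- z) = - phase m z.
Proof. by rewrite -scaleN1r phaseZ mulN1r. Qed.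

Lemma phaseDl (R : realType) k (m m' : 'rV[int]_k) (z : 'rV[R]_k) :
  phase (m + m') z = phase m z + phase m' z.
Proof.
by rewrite -big_split; apply: eq_bigr => i _; rewrite mxE intrD/=; ring.
Qed.

Lemma phaseNl (R : realType) k (m : 'rV[int]_k) (z : 'rV[R]_k) :
  phase (- m) z = - phase m z.
Proof. by rewrite -sumrN; apply: eq_bigr => i _; rewrite mxE intrN; ring. Qed.

Lemma phase0 (R : realType) k (z : 'rV[R]_k) : phase 0 z = 0.
Proof. by rewrite /phase big1// => i _; rewrite mxE mulr0 mulr0. Qed.

Lemma cos_phase_periodic (R : realType) k (m m' : 'rV[int]_k) (z : 'rV[R]_k) :
  cos (phase m (z + int_vec R m')) = cos (phase m z).
Proof.
rewrite phaseD -[RHS](@cos_addr_2pi_int _ _ (\sum_i m 0 i * m' 0 i)).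
congr (cos (_ + _)); rewrite rmorph_sum mulr_sumr; apply: eq_bigr => i _.
by rewrite /int_vec mxE rmorphM/=; ring.
Qed.

Lemma sinc_int_2pi (R : realType) (m : int) :
  sinc_int (2 * pi * m%:~R) 2^-1 = (m == 0)%:R :> R.
Proof.
rewrite /sinc_int; have [->|m0] := eqVneq m 0.
  by rewrite mulr0 eqxx mulfV.
rewrite mulf_eq0 intr_eq0 (negbTE m0) orbF mulf_eq0 pnatr_eq0/= gt_eqF ?pi_gt0//.
by rewrite (_ : 2 * pi * _ / 2 = pi * m%:~R) ?sin_pi_int ?mulr0 ?mul0r//; field.
Qed.

Lemma unit_cubeE (R : realType) k : @unit_cube R k = rV_box (fun=> `[(0:R), 1[%classic).
Proof.
by rewrite /unit_cube; congr rV_box; apply/funext => _.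
Qed.

Lemma integrable_cos_phase_cube (R : realType) k (m : 'rV[int]_k) :
  (lebesgue_rV k).-integrable (@unit_cube R k) (fun z => (cos (phase m z))%:E).
Proof.
rewrite unit_cubeE (_ : (fun z => _) = fun z : 'rV[R]_k => (cos (0 + phase m z))%:E); last first.
  by apply/funext => z; rewrite add0r.
apply: integrable_cos_box => i; first by [].
by rewrite lebesgue_measure_itv/= lte_fin ltr01 -EFinD ltry.
Qed.

Lemma integral_cos_phase_cube (R : realType) k (m : 'rV[int]_k) :
  (\int[lebesgue_rV k]_(z in @unit_cube R k) (cos (phase m z))%:E =
   ((m == 0)%:R)%:E)%E.
Proof.
rewrite unit_cubeE; under eq_integral do rewrite -[phase _ _]add0r.
rewrite (@integral_cos_box _ _ _ (fun i => (m 0 i == 0)%:R)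
  (fun i => 2^-1 * (2 * pi * (m 0 i)%:~R))).
- have [->|m0] := eqVneq m 0.
    rewrite !big1 ?addr0 ?cos0 ?mulr1// => i _; rewrite mxE ?eqxx//.
    by rewrite !mulr0.
  have /rV0Pn[i mi] := m0.
  by rewrite (bigD1 i)//= (negbTE mi) !mul0r.
- by move=> i; exact: measurable_itv.
- by move=> i; rewrite lebesgue_measure_itv/= lte_fin ltr01 -EFinD ltry.
- move=> i th; rewrite -sinc_int_2pi -[RHS](@integral_cos_itv _ true true)//.
  by rewrite subrr (_ : 2^-1 + 2^-1 = 1 :> R)//; field.
Qed.

(** * The Fejer kernel *)

Section fejer.
Variables (R : realType) (k N : nat).
Hypothesis N0 : (0 < N)%N.
Local Notation idx := {ffun 'I_k -> 'I_N}.

Definition freq (J : idx) : 'rV[int]_k := \row_i (J i : nat)%:Z.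

Lemma freq_inj : injective freq.
Proof.
move=> J L /rowP JL; apply/ffunP => i; apply/val_inj.
by have := JL i; rewrite !mxE => -[].
Qed.

Lemma card_idx : #|{: idx}| = (N ^ k)%N.
Proof. by rewrite card_ffun !card_ord. Qed.

(** The expansion of [N ^ k] to the power -1 times the squared modulus of the sum of the characters
    [freq J], that is, the product of [k] one-dimensional Fejer kernels. Indexing by pairs exhibits
    it as a trigonometric polynomial without collecting equal frequencies. *)
Definition fejer (z : 'rV[R]_k) : R :=
  \sum_(p : idx * idx) (N ^ k)%:R^-1 * cos (phase (freq p.1 - freq p.2) z).

Lemma fejer_ge0 z : 0 <= fejer z.
Proof.
rewrite /fejer -mulr_sumr mulr_ge0 ?invr_ge0//.
suff -> : \sum_(p : idx * idx) cos (phase (freq p.1 - freq p.2) z) =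
    (\sum_J cos (phase (freq J) z)) ^+ 2 + (\sum_J sin (phase (freq J) z)) ^+ 2.
  by rewrite addr_ge0// sqr_ge0.
rewrite -(pair_bigA _ (fun J L => cos (phase (freq J - freq L) z)))/=.
rewrite !expr2 !mulr_suml -big_split/=; apply: eq_bigr => J _.
rewrite !mulr_sumr -big_split/=; apply: eq_bigr => L _.
by rewrite phaseDl phaseNl cosB.
Qed.

Lemma fejer_periodic z (m : 'rV[int]_k) : fejer (z + int_vec R m) = fejer z.
Proof. by apply: eq_bigr => p _; rewrite cos_phase_periodic. Qed.

Lemma measurable_phase (m : 'rV[int]_k) :
  measurable_fun setT (fun z : 'rV[R]_k => cos (phase m z)).
Proof.
rewrite (_ : (fun z => _) = fun z : 'rV[R]_k => cos (0 + phase m z)).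
  exact: measurable_cos_sum.
by apply/funext => z; rewrite add0r.
Qed.

Lemma measurable_fejer : measurable_fun setT fejer.
Proof.
apply: measurable_sum => p; apply: measurable_funM => //; exact: measurable_phase.
Qed.

Let Nk0 : (N ^ k)%:R != 0 :> R.
Proof. by rewrite pnatr_eq0 expn_eq0 (gtn_eqF N0). Qed.

Lemma integrable_fejer :
  (lebesgue_rV k).-integrable (@unit_cube R k) (fun z => (fejer z)%:E).
Proof.
apply: integrable_finite_lincomb; first exact: measurable_unit_cube.
by move=> p; exact: integrable_cos_phase_cube.
Qed.

Lemma integral_fejer :
  (\int[lebesgue_rV k]_(z in @unit_cube R k) (fejer z)%:E = 1)%E.
Proof.
rewrite (integral_finite_lincomb _ (r := fun p => (freq p.1 - freq p.2 == 0)%:R)).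
- congr (_%:E); rewrite -mulr_sumr.
  rewrite -(pair_bigA _ (fun J L => (freq J - freq L == 0)%:R))/=.
  rewrite (eq_bigr (fun=> 1)) ?sumr_const ?card_idx ?mulVf// => J _.
  rewrite (bigD1 J)//= subrr eqxx big1 ?addr0// => L LJ.
  by rewrite subr_eq0 (inj_eq freq_inj) eq_sym (negbTE LJ).
- exact: measurable_unit_cube.
- by move=> p; exact: integrable_cos_phase_cube.
- by move=> p; exact: integral_cos_phase_cube.
Qed.

Lemma card_ord_succ_lt : #|[pred c : 'I_N | (c.+1 < N)%N]| = N.-1.
Proof.
rewrite -sum1_card big_mkcond; move: N0; case: (N) => // N' _.
rewrite big_ord_recr/= inE ltnn addn0 -[RHS]card_ord -sum1_card.
by apply: eq_bigr => c _; rewrite inE /= ltnS ltn_ord.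
Qed.

(** Raising coordinate [i] by one stays in range for [N.-1] of its [N] values. The factor [N] on the
    left avoids the exponent [k - 1]. *)
Lemma card_idx_lt (i : 'I_k) :
  (#|[pred J : idx | (J i).+1 < N]| * N = N.-1 * N ^ k)%N.
Proof.
pose Fm (j : 'I_k) : pred 'I_N := if j == i then [pred c : 'I_N | (c.+1 < N)%N] else predT.
have -> : #|[pred J : idx | (J i).+1 < N]%N| = #|family Fm|.
  apply: eq_card => J; rewrite [LHS]inE /=; apply/idP/familyP => [Ji j|/(_ i)].
    by rewrite /Fm; case: eqP => [->|_]; rewrite inE.
  by rewrite /Fm eqxx inE.
rewrite card_family foldrE big_map big_enum/=.
rewrite (bigD1 i)//= {1}/Fm eqxx card_ord_succ_lt.
rewrite (eq_bigr (fun=> N)); last first.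
  by move=> j /negbTE ji; rewrite /Fm ji cardT size_enum_ord.
rewrite prod_nat_const -mulnA -expnSr; congr (_ * _ ^ _)%N.
rewrite (_ : #|_| = #|[pred j | j != i]|)//.
by rewrite cardC1 card_ord prednK// (leq_ltn_trans _ (ltn_ord i)).
Qed.

(** The equation forces [L] to be [J] raised by one in coordinate [i], which is an index exactly
    when [(J i).+1 < N]. *)
Lemma sum_freq_shift (i : 'I_k) :
  \sum_(J : idx) \sum_(L : idx) (freq J - freq L + delta_mx 0 i == 0)%:R =
  #|[pred J : idx | (J i).+1 < N]%N|%:R :> R.
Proof.
rewrite -sum1_card natr_sum [RHS]big_mkcond/=; apply: eq_bigr => J _.
case: ifPn => [|/negP]; rewrite inE /= => Ji; last first.
  rewrite big1// => L _; case: eqP => // /rowP /(_ i); rewrite !mxE !eqxx /= => E.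
  by exfalso; apply: Ji; have := ltn_ord (L i); lia.
pose L0 : idx := [ffun j => if j == i then Ordinal Ji else J j].
have L0E : freq L0 = freq J + delta_mx 0 i.
  apply/rowP => j; rewrite !mxE ffunE eqxx; case: eqP => [->|_] /=.
    by rewrite -addn1 PoszD.
  by rewrite addr0.
rewrite (bigD1 L0)//= big1 ?addr0 => [|L LL0].
  by rewrite L0E opprD addrA subrr add0r addNr eqxx.
rewrite addrAC -L0E subr_eq0 (inj_eq freq_inj) eq_sym (negbTE LL0)//.
Qed.

Let dirac_phase (i : 'I_k) (z : 'rV[R]_k) : phase (delta_mx 0 i) z = 2 * pi * z 0 i.
Proof.
rewrite /phase (bigD1 i)//= big1 => [|j ji]; last by rewrite mxE (negbTE ji) andbF !mulr0.
by rewrite mxE !eqxx addr0 mulr1 mulrC.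
Qed.

Let sgn_delta (i : 'I_k) (b : bool) : 'rV[int]_k := if b then delta_mx 0 i else - delta_mx 0 i.

(** Multiplication by [cos (2 * pi * z 0 i)] shifts every frequency by plus and by minus a unit
    vector, each with weight 1/2; the Boolean index is that sign. *)
Let fejer_momentE (i : 'I_k) z : fejer z * (1 - cos (2 * pi * z 0 i)) =
  fejer z - \sum_(p : (idx * idx) * bool)
    (2^-1 * (N ^ k)%:R^-1) * cos (phase (freq p.1.1 - freq p.1.2 + sgn_delta i p.2) z).
Proof.
rewrite mulrBr mulr1; congr (_ - _).
rewrite -(pair_bigA _ (fun q b => (2^-1 * (N ^ k)%:R^-1) *
   cos (phase (freq q.1 - freq q.2 + sgn_delta i b) z)))/=.
rewrite /fejer mulr_suml; apply: eq_bigr => p _.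
rewrite big_bool/= !(phaseDl (freq p.1 - freq p.2)) phaseNl dirac_phase cosB cosD.
by field.
Qed.

Lemma integrable_fejer_moment (i : 'I_k) :
  (lebesgue_rV k).-integrable (@unit_cube R k)
    (fun z => (fejer z * (1 - cos (2 * pi * z 0 i)))%:E).
Proof.
under eq_fun do rewrite fejer_momentE EFinB.
have mC := @measurable_unit_cube R k.
apply: integrableB => //; first exact: integrable_fejer.
by apply: integrable_finite_lincomb => // p; exact: integrable_cos_phase_cube.
Qed.

(** The kernel has mean 1 and its Fourier coefficient at a unit frequency is [(N - 1) / N]; the
    moment is the difference. *)
Lemma integral_fejer_moment (i : 'I_k) :
  (\int[lebesgue_rV k]_(z in @unit_cube R k)
    (fejer z * (1 - cos (2 * pi * z 0 i)))%:E = (N%:R^-1)%:E)%E.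
Proof.
have mC := @measurable_unit_cube R k.
under eq_integral do rewrite fejer_momentE EFinB.
rewrite integralB//; last 2 first.
- exact: integrable_fejer.
- by apply: integrable_finite_lincomb => // p; exact: integrable_cos_phase_cube.
rewrite integral_fejer.
rewrite (integral_finite_lincomb _
  (r := fun p => (freq p.1.1 - freq p.1.2 + sgn_delta i p.2 == 0)%:R))//; last 2 first.
- by move=> p; exact: integrable_cos_phase_cube.
- by move=> p; exact: integral_cos_phase_cube.
rewrite -mulr_sumr.
rewrite -(pair_bigA _ (fun q b => (freq q.1 - freq q.2 + sgn_delta i b == 0)%:R))/=.
rewrite (eq_bigr _ (fun p _ => big_bool _ _))/= big_split/=.
rewrite -(pair_bigA _ (fun J L => (freq J - freq L + delta_mx 0 i == 0)%:R))/=.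
rewrite -(pair_bigA _ (fun J L => (freq J - freq L - delta_mx 0 i == 0)%:R))/=.
(* Exchanging [J] and [L] reverses the sign of the shift. *)
have -> : \sum_(J : idx) \sum_(L : idx) (freq J - freq L - delta_mx 0 i == 0)%:R =
    \sum_(J : idx) \sum_(L : idx) (freq J - freq L + delta_mx 0 i == 0)%:R :> R.
  rewrite exchange_big/=; apply: eq_bigr => J _; apply: eq_bigr => L _.
  by rewrite -oppr_eq0 opprD opprK opprB.
rewrite sum_freq_shift -EFinB; congr (_%:E).
have /(congr1 (fun m => m%:R : R)) := card_idx_lt i; rewrite !natrM => E.
have N0' : N%:R != 0 :> R by rewrite pnatr_eq0 -lt0n.
have NE : N.-1%:R = N%:R - 1 :> R by rewrite -{2}(prednK N0) -natr1 addrK.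
rewrite NE in E.
have -> : #|[pred J : idx | (J i).+1 < N]%N|%:R = (N%:R - 1) * (N ^ k)%:R / N%:R :> R.
  by rewrite -E mulfK.
by field; rewrite N0' Nk0.
Qed.

(** Distance to the lattice is measured by [1 - cos], whose integral against the kernel is explicit;
    [near_latticeP] converts it to the usual distance. *)
Definition near_lattice (kappa : R) : set 'rV[R]_k :=
  [set q | forall i, 1 - cos (2 * pi * q 0 i) < kappa].

Lemma measurable_near_lattice kappa : measurable (near_lattice kappa).
Proof.
rewrite (_ : near_lattice _ = \bigcap_(i in [set: 'I_k])
    [set q | 1 - cos (phase (delta_mx 0 i) q) < kappa]); last first.
  apply/seteqP; split => q /= h i; [move=> _ /=; rewrite dirac_phase; exact: h|].
  by rewrite -dirac_phase; apply: h.
apply: fin_bigcap_measurable; first exact: finite_finset.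
move=> i _.
have m1 : measurable_fun setT (fun q : 'rV[R]_k => 1 - cos (phase (delta_mx 0 i) q)).
  by apply: measurable_funB => //; exact: measurable_phase.
rewrite -[X in measurable X]setTI (_ : [set _ | _] =
  (fun q : 'rV[R]_k => 1 - cos (phase (delta_mx 0 i) q)) @^-1` `]-oo, kappa[%classic).
  exact: m1.
by apply/seteqP; split => q /=; rewrite in_itv.
Qed.

(* Markov's inequality for the moments of [1 - cos (2 pi q_i)], each equal to [1 / N]. *)
Lemma fejer_tail kappa : 0 < kappa ->
  (\int[lebesgue_rV k]_(q in @unit_cube R k)
     ((fejer q)%:E * (\1_(~` near_lattice kappa) q)%:E) <=
   (k%:R / (N%:R * kappa))%:E)%E.
Proof.
move=> kap0; have mC := @measurable_unit_cube R k.
have cos0 (q : 'rV[R]_k) i : 0 <= 1 - cos (2 * pi * q 0 i) by rewrite subr_ge0 cos_le1.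
apply: (@le_trans _ _ (\int[lebesgue_rV k]_(q in @unit_cube R k)
   (\sum_(i < k) kappa^-1 * (fejer q * (1 - cos (2 * pi * q 0 i))))%:E)%E); last first.
  rewrite (integral_finite_lincomb _ (r := fun=> N%:R^-1))//.
  - by rewrite sumr_const card_ord lee_fin -[leLHS]mulr_natl invfM [kappa^-1 * _]mulrC.
  - by move=> i; exact: integrable_fejer_moment.
  - by move=> i; exact: integral_fejer_moment.
have mI : measurable_fun setT (fun q =>
    (\sum_(i < k) kappa^-1 * (fejer q * (1 - cos (2 * pi * q 0 i))))%:E).
  apply/measurable_EFinP; apply: measurable_sum => i; apply: measurable_funM => //.
  apply: measurable_funM; first exact: measurable_fejer.
  apply: measurable_funB => //; under eq_fun do rewrite -dirac_phase.
  exact: measurable_phase.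
apply: ge0_le_integral => //.
- by move=> q _; rewrite mule_ge0 ?lee_fin ?fejer_ge0 ?indicE.
- apply: measurable_funTS; apply: emeasurable_funM.
    by apply/measurable_EFinP; exact: measurable_fejer.
  by apply: measurable_indicE; apply: measurableC; exact: measurable_near_lattice.
- exact: measurable_funTS.
move=> q _; rewrite -EFinM lee_fin indicE.
have S0 : 0 <= \sum_(i < k) kappa^-1 * (fejer q * (1 - cos (2 * pi * q 0 i))).
  by apply: sumr_ge0 => i _; rewrite mulr_ge0 ?invr_ge0 ?(ltW kap0)// mulr_ge0 ?fejer_ge0.
have [/set_mem /= nN|_] := boolP (q \in _); last by rewrite mulr0.
have /existsNP[i /negP] := nN; rewrite -leNgt => ki.
rewrite mulr1 (bigD1 i)//=.
apply: (@le_trans _ _ (kappa^-1 * (fejer q * (1 - cos (2 * pi * q 0 i))))).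
  rewrite mulrCA; rewrite -[leLHS]mulr1; apply: ler_wpM2l; first exact: fejer_ge0.
  by rewrite mulrC ler_pdivlMr// mul1r.
rewrite lerDl; apply: sumr_ge0 => j _.
by rewrite mulr_ge0 ?invr_ge0 ?(ltW kap0)// mulr_ge0 ?fejer_ge0.
Qed.
End fejer.

(** * Diophantine sums *)

(** With [u] the distance from [s] to the nearest integer, [1 - cos (2 * pi * s)] is twice the
    square of [sin (pi * u)]. For [rho <= 1/4] one has [pi * rho <= 1], so the mean value theorem
    gives [sin (pi * rho) >= cos 1 * rho]; this is the origin of [cos 1]. Then [u > rho] would
    contradict the assumption. *)
Lemma near_int (R : realType) (rho s : R) : 0 < rho -> rho <= 4^-1 ->
  1 - cos (2 * pi * s) < (cos 1 * rho) ^+ 2 ->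
  exists m : int, `|s + m%:~R| <= rho.
Proof.
move=> rho0 rho4 near.
exists (- Num.floor (s + 2^-1)); rewrite rmorphN/=.
set f := Num.floor _; have /andP[] := floor_itv (s + 2^-1).
rewrite -/f intrD => f1 f2.
pose u := `|s - f%:~R|; have u2 : u <= 2^-1 by rewrite ler_norml; lra.
rewrite leNgt; apply/negP => rhou; rewrite -/u in rhou.
have cosu : cos (2 * pi * s) = cos (2 * pi * u).
  transitivity (cos (2 * pi * (s - f%:~R))).
    by rewrite -[RHS](@cos_addr_2pi_int _ _ f); congr cos; ring.
  by rewrite /u; case: ger0P => // _; rewrite -cosN; congr cos; ring.
have sinu : 1 - cos (2 * pi * s) = 2 * sin (pi * u) ^+ 2.
  rewrite cosu (_ : 2 * pi * u = (pi * u) *+ 2); last by rewrite -mulr_natl; ring.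
  by rewrite cos_mulr2n -mulr_natl cos2sin2; ring.
have pi0 := @pi_gt0 R; have pi4 : pi < 4 :> R by have := @pihalf_lt2 R; lra.
have c10 := @cos1_gt0 R.
have sinrho : cos 1 * rho <= sin (pi * rho).
  have [xi xiI] : exists2 xi, xi \in `[0, pi * rho] &
      sin (pi * rho) - sin 0 = cos xi * (pi * rho - 0).
    apply: MVT_segment; first by rewrite mulr_ge0 ?ltW.
    by apply: continuous_subspaceT => x; exact: continuous_sin.
  rewrite sin0 !subr0 => ->; move: xiI; rewrite in_itv/= => /andP[xi0 xir].
  have pr1 : pi * rho <= 1 by nra.
  have cc : cos 1 <= cos xi.
    have [->//|x1] := eqVneq xi 1; apply: ltW; rewrite ltr_cos ?in_itv/=.
    - by rewrite lt_neqAle x1 (le_trans xir).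
    - by apply/andP; split; have := @pihalf_ge1 R; lra.
    - by apply/andP; split; have := @pihalf_ge1 R; lra.
  have pi2 := @pi_ge2 R.
  by apply: ler_pM; rewrite ?(ltW c10) ?(ltW rho0)//; nra.
have sinru : sin (pi * rho) <= sin (pi * u).
  apply: ltW; rewrite ltr_sin ?in_itv/= ?ltr_pM2l//.
  - by apply/andP; split; nra.
  - by apply/andP; split; nra.
move: near; rewrite sinu.
have : 0 < cos 1 * rho by rewrite mulr_gt0.
nra.
Qed.

Lemma near_latticeP (R : realType) k (rho : R) (q : 'rV[R]_k) :
  0 < rho -> rho <= 4^-1 -> near_lattice ((cos 1 * rho) ^+ 2) q ->
  exists m : 'rV[int]_k, forall i, `|(q + int_vec R m) 0 i| <= rho.
Proof.
move=> rho0 rho4 nq.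
have /fin_all_exists[m mE] i := near_int rho0 rho4 (nq i).
by exists (\row_i m i) => i; rewrite /int_vec !mxE.
Qed.

(** The value at 0 implements [1 / 0 = oo] inside the minimum; the field convention [0^-1 = 0] would
    give 0 instead. *)
Definition min1V (R : realType) (x : R) : R :=
  if x == 0 then 1 else Num.min 1 `|x|^-1.

Lemma min1V_ge0 (R : realType) (x : R) : 0 <= min1V x.
Proof. by rewrite /min1V; case: ifP => // _; rewrite le_min ler01 invr_ge0. Qed.

Lemma min1V_gt0 (R : realType) (x : R) : 0 < min1V x.
Proof.
by rewrite /min1V; case: ifPn => // x0; rewrite lt_min ltr01 invr_gt0 normr_gt0.
Qed.

(** The real counterpart of the summand in [strongly_diophantine]. As [0^-1 = 0] in the field, the
    two agree only where no denominator vanishes, which [dioph_neq0] guarantees for [m != 0]. *)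
Definition dioph_weight (R : realType) d k (w : d.-tuple 'rV[R]_k)
    (v : k.-tuple 'rV[R]_k) (m : 'rV[int]_k) : R :=
  (\prod_(i < k) min1V (dotr v`_i (int_vec R m))) *
  \prod_(i < d) `|dotr (int_vec R m) w`_i|^-1.

Lemma r_basisE (R : realType) k (v : k.-tuple 'rV[R]_k) (m : 'rV[R]_k) :
  r_basis v m = (\prod_(i < k) min1V (dotr v`_i m))%:E.
Proof.
rewrite /r_basis -prodEFin; apply: eq_bigr => i _; rewrite /min1V inver normr_eq0.
case: ifP => _; last by rewrite EFin_min.
by rewrite minEle leey.
Qed.

Lemma int_vec_norm_le (R : realType) k (m : 'rV[int]_k) (M : R) : 0 <= M ->
  (forall i, `|(m 0 i)%:~R| <= M) -> `|int_vec R m| <= M.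
Proof.
move=> M0 mM; rewrite [leLHS]mx_normrE; apply/bigmax_leP; split => // -[i j] _ /=.
by rewrite /int_vec mxE ord1.
Qed.

Section diophantine.
Variables (R : realType) (d k : nat) (w : d.-tuple 'rV[R]_k) (v : k.-tuple 'rV[R]_k).
Hypothesis hdioph : strongly_diophantine w v.

Let term_ge0 (m : 'rV[int]_k) : (0 <= r_basis v (int_vec R m) *
  \prod_(i < d) (`|dotr (int_vec R m) w`_i|%:E)^-1)%E.
Proof.
rewrite mule_ge0//; first by rewrite r_basisE lee_fin prodr_ge0// => i _; exact: min1V_ge0.
by apply: prode_ge0 => i _; rewrite inve_ge0 lee_fin.
Qed.

(** A vanishing product would make one factor of the summand at [m] equal to [+oo]. The other
    factors are positive, so the whole sum would be infinite, against the bound for exponent 1 and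
    any [M] beyond the norm of [m]. *)
Lemma dioph_neq0 (m : 'rV[int]_k) (i : 'I_d) : m != 0 -> dotr (int_vec R m) w`_i != 0.
Proof.
move=> m0; apply/negP => /eqP mwi.
have M0 : 0 < `|int_vec R m| + 1 by rewrite ltr_wpDl.
have [C C0 /(_ _ M0)] := hdioph (@ltr01 R).
apply/negP; rewrite -ltNge; apply: (@lt_le_trans _ _ +oo%E); first exact: ltry.
apply: esum_ge; exists [set m].
  split => // _ ->; split; first exact/eqP.
  by rewrite lerDl.
rewrite fsbig_set1 (bigD1 i)//= mwi normr0 inve0.
set A := r_basis _ _; set B := (\prod_(j < d | _) _)%E.
have A0 : (0 < A)%E.
  by rewrite /A r_basisE lte_fin prodr_gt0// => j _; exact: min1V_gt0.
have B0 : (0 < B)%E.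
  rewrite /B; elim/big_ind : _ => [|x y x0 y0|j _]; first by rewrite lte01.
    exact: mule_gt0.
  rewrite inver; case: ifPn => // wj0.
  by rewrite lte_fin invr_gt0 lt0r wj0 normr_ge0.
by rewrite gt0_mulye// gt0_muley.
Qed.

Lemma dioph_termE (m : 'rV[int]_k) : m != 0 ->
  (r_basis v (int_vec R m) * \prod_(i < d) (`|dotr (int_vec R m) w`_i|%:E)^-1 =
   (dioph_weight w v m)%:E)%E.
Proof.
move=> m0; rewrite r_basisE /dioph_weight EFinM -[X in (_ = _ * X)%E]prodEFin.
congr (_ * _)%E; apply: eq_bigr => i _.
by rewrite inver normr_eq0 (negbTE (dioph_neq0 i m0)).
Qed.

(** For fixed [L] the differences [freq J - freq L] are distinct, nonzero and of sup norm below [N],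
    so this is part of the nonnegative sum at [M = N]. *)
Lemma dioph_sum_le (eps : R) : 0 < eps -> exists2 C : R, 0 < C &
  forall N (L : {ffun 'I_k -> 'I_N}), (0 < N)%N ->
    \sum_(J | J != L) dioph_weight w v (freq J - freq L) <= C * N%:R `^ eps.
Proof.
move=> eps0; have [C C0 HC] := hdioph eps0; exists C => // N L N0.
rewrite -lee_fin; apply: le_trans (HC N%:R _); last by rewrite ltr0n.
apply: esum_ge.
pose r := [seq freq J - freq L | J <- enum [pred J | J != L]].
have ur : uniq r.
  rewrite map_inj_uniq ?enum_uniq// => J J' /addIr; exact: freq_inj.
exists [set` r].
  split; first exact: finite_seq.
  move=> m /= /mapP[J]; rewrite mem_enum inE => JL ->; split.
    by apply/eqP; rewrite subr_eq0 (inj_eq (@freq_inj _ _)).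
  apply: int_vec_norm_le => // i; rewrite !mxE.
  have := ltn_ord (J i); have := ltn_ord (L i).
  rewrite -(ltr_nat R) => lL; rewrite -(ltr_nat R) => lJ.
  have J0 : 0 <= (J i)%:R :> R by []. have L0 : 0 <= (L i)%:R :> R by [].
  by rewrite intrB/= -!pmulrn ler_norml; apply/andP; split; lra.
rewrite -fsbig_seq// big_map big_enum/= -sumEFin; apply: lee_sum => J JL.
by rewrite dioph_termE// subr_eq0 (inj_eq (@freq_inj _ _)).
Qed.
End diophantine.

(** * Parallelotopes and the linear flow *)

Lemma dotrE (R : realType) k (u z : 'rV[R]_k) : dotr u z = \sum_i u 0 i * z 0 i.
Proof. by rewrite /dotr mxE; apply: eq_bigr => i _; rewrite mxE. Qed.

Lemma dotrC (R : realType) k (u z : 'rV[R]_k) : dotr u z = dotr z u.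
Proof. by rewrite !dotrE; apply: eq_bigr => i _; rewrite mulrC. Qed.

Lemma phase_dotr (R : realType) k (m : 'rV[int]_k) (u : 'rV[R]_k) :
  phase m u = 2 * pi * dotr u (int_vec R m).
Proof.
by rewrite dotrE mulr_sumr; apply: eq_bigr => i _; rewrite /int_vec mxE; ring.
Qed.

Lemma phase_lincomb (R : realType) d k (w : d.-tuple 'rV[R]_k) (m : 'rV[int]_k) s :
  phase m (lincomb w s) = \sum_(i < d) s 0 i * phase m w`_i.
Proof.
rewrite /lincomb; elim/big_ind2 : _ => [|z a z' a' <- <-|i _].
- by rewrite /phase big1// => i _; rewrite mxE mul0r.
- exact: phaseD.
- exact: phaseZ.
Qed.

Lemma norm_sin_le (R : realType) (y : R) : `|sin y| <= `|y|.
Proof.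
wlog y0 : y / 0 <= y => [hw|].
  have [/hw//|/ltW] := leP 0 y; rewrite -oppr_ge0 => /hw.
  by rewrite sinN !normrN.
have [xi _] : exists2 xi, xi \in `[0, y] & sin y - sin 0 = cos xi * (y - 0).
  apply: MVT_segment => //.
  by apply: continuous_subspaceT => x; exact: continuous_sin.
rewrite sin0 !subr0 => ->; rewrite normrM -[leRHS]mul1r ler_wpM2r//.
exact: cos_max.
Qed.

(** Uniform in [h], hence suited to the flow directions, where [h] is the unbounded time [T]. *)
Lemma sinc_int_le_inv (R : realType) (x h : R) : x != 0 ->
  `|sinc_int (2 * pi * x) h| <= `|x|^-1.
Proof.
move=> x0; have pi2 := @pi_ge2 R; have pi0 := @pi_gt0 R.
have p0 : 2 * pi * x != 0 by rewrite !mulf_neq0// gt_eqF.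
rewrite /sinc_int (negbTE p0) normrM normfV ler_pdivrMr ?normr_gt0//.
rewrite [`|_ * x|]normrM mulrCA mulVf ?normr_eq0// mulr1 !normrM ler_wpM2l//.
by rewrite (le_trans (sin_max _))// gtr0_norm//; lra.
Qed.

(** Meant for the sides of the parallelotope: the trivial bound by the length [2 * h] and the decay
    in [x] are merged, at the price of the factor [1 + 2 * h]. *)
Lemma sinc_int_le (R : realType) (x h : R) : 0 <= h ->
  `|sinc_int (2 * pi * x) h| <= (1 + 2 * h) * min1V x.
Proof.
move=> h0; rewrite /min1V; case: ifPn => [/eqP ->|x0].
  by rewrite mulr0 /sinc_int eqxx mulr1 ger0_norm ?mulr_ge0//; lra.
have l1 := sinc_int_le_inv h x0.
have l2 : `|sinc_int (2 * pi * x) h| <= 2 * h.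
  have p0 : 2 * pi * x != 0 by rewrite !mulf_neq0// gt_eqF// pi_gt0.
  rewrite /sinc_int (negbTE p0) normrM normfV ler_pdivrMr ?normr_gt0//.
  rewrite normrM (@ger0_norm R 2)// -(mulrA 2 h) ler_wpM2l//.
  by rewrite (le_trans (norm_sin_le _))// normrM (ger0_norm h0) mulrC.
have [x1|x1] := leP 1 `|x|^-1.
  by rewrite mulr1; lra.
apply: (le_trans l1); rewrite -[leLHS]mul1r ler_wpM2r ?invr_ge0//; lra.
Qed.

Definition basis_mx (R : realType) d k (v : d.-tuple 'rV[R]_k) : 'M[R]_(d, k) :=
  \matrix_(i < d) v`_i.

Lemma lincombE (R : realType) d k (v : d.-tuple 'rV[R]_k) a :
  lincomb v a = a *m basis_mx v.
Proof. by rewrite mulmx_sum_row; apply: eq_bigr => i _; rewrite rowK. Qed.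

Lemma lincomb_inj (R : realType) d k (w : d.-tuple 'rV[R]_k) : free w ->
  injective (lincomb w).
Proof.
move=> /freeP fw a b ab; apply/rowP => i; apply/eqP; rewrite -subr_eq0; apply/eqP.
apply: (fw (fun j => a 0 j - b 0 j)).
under eq_bigr do rewrite scalerBl.
by rewrite sumrB; apply/eqP; rewrite subr_eq0; apply/eqP.
Qed.

Lemma basis_mx_free (R : realType) d k (v : d.-tuple 'rV[R]_k) : free v ->
  row_free (basis_mx v).
Proof.
move=> /lincomb_inj vi; apply: inj_row_free => a a0.
by apply: vi; rewrite !lincombE a0 mul0mx.
Qed.

Section flow.
Variables (R : realType) (d k : nat) (w : d.-tuple 'rV[R]_k) (v : k.-tuple 'rV[R]_k).
Local Notation W := (basis_mx v).
Variable N : nat.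

(* Empty as soon as some [h i < 0]; hence the [Num.max 0 (h i)] in the integrals below. *)
Definition centred_box n (ctr h : 'I_n -> R) : set 'rV[R]_n :=
  rV_box (fun i => `[ctr i - h i, ctr i + h i]%classic).

(** The centre and the half-widths are coordinates in the basis [v] relative to [y]. Moving the
    faces changes [h] alone, so the phases of the resulting trigonometric sums are the same for the
    enlarged and the shrunk box. *)
Definition tilted_box (y : 'rV[R]_k) (ctr h : 'I_k -> R) : set 'rV[R]_k :=
  [set z | centred_box ctr h ((z - y) *m invmx W)].

Lemma measurable_centred_box n (ctr h : 'I_n -> R) : measurable (centred_box ctr h).
Proof. by apply: measurable_rV_box => i; exact: measurable_itv. Qed.

Lemma measurable_tilted_box y ctr h : measurable (tilted_box y ctr h).
Proof.
rewrite -[X in measurable X]setTI.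
have := measurableT_comp (@measurable_mulmxr R k k (invmx W)) (@measurable_rV_addr R k (- y)).
by apply => //; exact: measurable_centred_box.
Qed.

Lemma integrable_cos_centred_box n th (l ctr h : 'I_n -> R) :
  (lebesgue_rV n).-integrable (centred_box ctr h)
    (fun a => (cos (th + \sum_i a 0 i * l i))%:E).
Proof.
apply: integrable_cos_box => i; first exact: measurable_itv.
by rewrite lebesgue_measure_itv/=; case: ifP => _; rewrite -?EFinD ltry.
Qed.

Lemma integral_cos_centred_box n th (l ctr h : 'I_n -> R) :
  (\int[lebesgue_rV n]_(a in centred_box ctr h) (cos (th + \sum_i a 0 i * l i))%:E =
   ((\prod_i sinc_int (l i) (Num.max 0 (h i))) *
    cos (th + \sum_i ctr i * l i))%:E)%E.
Proof.
apply: integral_cos_box => [i|i|i {}th]; first exact: measurable_itv.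
  by rewrite lebesgue_measure_itv/=; case: ifP => _; rewrite -?EFinD ltry.
have [h0|h0] := leP 0 (h i).
  by rewrite -(@integral_cos_itv _ true false)//; congr integral.
rewrite set_itv_ge ?integral_set0; last by rewrite bnd_simp -ltNge; lra.
by rewrite /sinc_int; case: ifP => _; rewrite !(mulr0, sin0, mul0r).
Qed.

Lemma lebesgue_centred_box n (ctr h : 'I_n -> R) :
  (lebesgue_rV n (centred_box ctr h) = (\prod_i (2 * Num.max 0 (h i)))%:E)%E.
Proof.
rewrite lebesgue_rV_box; last by move=> i; exact: measurable_itv.
rewrite -prodEFin; apply: eq_bigr => i _; rewrite lebesgue_measure_itv/= lte_fin.
have [h0|h0] := leP 0 (h i); last by rewrite ifF ?mulr0//; lra.
by case: ifP => hh; rewrite -?EFinD; congr (_%:E); lra.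
Qed.

Variable c : R.
Hypothesis Wu : W \in unitmx.
Hypothesis Hc : forall h : 'rV[R]_k -> \bar R,
    measurable_fun setT h -> (forall x, 0 <= h x)%E ->
    (\int[lebesgue_rV k]_x h x = c%:E * \int[lebesgue_rV k]_a h (a *m W)%R)%E.

Lemma mem_tilted_box y ctr h a :
  (a *m W + y \in tilted_box y ctr h) = (a \in centred_box ctr h).
Proof. by apply/idP/idP; rewrite !inE /tilted_box/= addrK mulmxK. Qed.

Lemma lebesgue_tilted_box y ctr h :
  (lebesgue_rV k (tilted_box y ctr h) = (c * \prod_i (2 * Num.max 0 (h i)))%:E)%E.
Proof.
have mA := measurable_tilted_box y ctr h.
have <- : (\int[lebesgue_rV k]_x (\1_(tilted_box y ctr h) x)%:E)%E =
    lebesgue_rV k (tilted_box y ctr h).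
  by rewrite integral_indic// setIT.
have mI := @measurable_indicE R _ _ _ mA.
rewrite -(ge0_integral_rV_addr y)//.
rewrite Hc; last 2 first.
- exact: (measurableT_comp mI (measurable_rV_addr y)).
- by move=> x; exact: indicE_ge0.
rewrite EFinM; congr (_ * _)%E; rewrite -(lebesgue_centred_box ctr).
transitivity (\int[lebesgue_rV k]_a (\1_(centred_box ctr h) a)%:E)%E.
  by apply: eq_integral => a _; rewrite !indicE mem_tilted_box.
by rewrite integral_indic ?setIT//; exact: measurable_centred_box.
Qed.

Lemma phase_mulmx (m : 'rV[int]_k) (a : 'rV[R]_k) :
  phase m (a *m W) = \sum_(i < k) a 0 i * phase m v`_i.
Proof. by rewrite -lincombE phase_lincomb. Qed.

(** In the coordinates of the basis each cosine of the kernel is integrated over a box, which yields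
    a product of transforms of intervals; [c] accounts for the change of variables. *)
Lemma smooth_indic_tilted_box (N0 : (0 < N)%N) y ctr h z :
  (smooth_indic (fejer N) (tilted_box y ctr h) z =
   (c * \sum_(p : {ffun 'I_k -> 'I_N} * {ffun 'I_k -> 'I_N})
    ((N ^ k)%:R^-1 * \prod_(i < k) sinc_int (phase (freq p.1 - freq p.2) v`_i) (Num.max 0 (h i))) *
      cos (phase (freq p.1 - freq p.2) (z - y) -
           \sum_(i < k) ctr i * phase (freq p.1 - freq p.2) v`_i))%:E)%E.
Proof.
have mA := measurable_tilted_box y ctr h.
have mI := @measurable_indicE R _ _ _ mA.
have mF : measurable_fun setT (fun z : 'rV[R]_k => (fejer N z)%:E).
  by apply/measurable_EFinP; exact: measurable_fejer.
have mFz : measurable_fun setT (fun p : 'rV[R]_k =>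
    ((fejer N (p - z))%:E * (\1_(tilted_box y ctr h) p)%:E)%E).
  by apply: emeasurable_funM => //; exact: (measurableT_comp mF (measurable_rV_addr (- z))).
have F0 (p : 'rV[R]_k) : (0 <= (fejer N (p - z))%:E * (\1_(tilted_box y ctr h) p)%:E)%E.
  by rewrite mule_ge0 ?indicE_ge0// lee_fin fejer_ge0.
rewrite /smooth_indic -(ge0_integral_rV_addr y)// Hc; last 2 first.
- exact: (measurableT_comp mFz (measurable_rV_addr y)).
- by move=> p; exact: F0.
rewrite EFinM; congr (_ * _)%E.
transitivity (\int[lebesgue_rV k]_(a in centred_box ctr h) (fejer N (a *m W + y - z))%:E)%E.
  rewrite [RHS]integral_mkcond; apply: eq_integral => a _; rewrite patchE indicE.
  by rewrite mem_tilted_box; case: ifP => _; rewrite ?mule1 ?mule0.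
have mC := measurable_centred_box ctr h.
have fE a : fejer N (a *m W + y - z) = \sum_(p : {ffun 'I_k -> 'I_N} * {ffun 'I_k -> 'I_N})
    (N ^ k)%:R^-1 * cos (phase (freq p.1 - freq p.2) (y - z) +
      \sum_(i < k) a 0 i * phase (freq p.1 - freq p.2) v`_i).
  apply: eq_bigr => p _; congr (_ * cos _).
  by rewrite -[a *m W + y - z]addrA (phaseD _ (a *m W)) phase_mulmx [LHS]addrC.
under eq_integral do rewrite fE.
rewrite (integral_finite_lincomb _ (r := fun p : {ffun 'I_k -> 'I_N} * {ffun 'I_k -> 'I_N} =>
  \prod_(i < k) sinc_int (phase (freq p.1 - freq p.2) v`_i) (Num.max 0 (h i)) *
  cos (phase (freq p.1 - freq p.2) (y - z) +
           \sum_(i < k) ctr i * phase (freq p.1 - freq p.2) v`_i)))//; last 2 first.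
- by move=> p; exact: integrable_cos_centred_box.
- by move=> p; exact: integral_cos_centred_box.
congr (_%:E); apply: eq_bigr => p _; rewrite mulrA -[in LHS]cosN; congr (_ * cos _).
by rewrite opprD -phaseN opprB.
Qed.

(* The integral of the smoothed indicator of a parallelotope along the flow, up to
   the factor [c]: see [integral_smooth_flow]. *)
Definition fejer_flow (h : 'I_k -> R) (T : R) (th : 'rV[int]_k -> R) : R :=
  \sum_(p : {ffun 'I_k -> 'I_N} * {ffun 'I_k -> 'I_N})
    (N ^ k)%:R^-1 * (\prod_(i < k) sinc_int (phase (freq p.1 - freq p.2) v`_i) (Num.max 0 (h i)) *
      \prod_(j < d) sinc_int (phase (freq p.1 - freq p.2) w`_j) T * cos (th (freq p.1 - freq p.2))).

Lemma integral_smooth_flow (N0 : (0 < N)%N) y ctr h x (T : R) : 0 <= c -> 0 <= T ->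
  (\int[lebesgue_rV d]_(s in centred_box (fun=> 0%R) (fun=> T))
     smooth_indic (fejer N) (tilted_box y ctr h) (x + lincomb w s)%R =
   (c * fejer_flow h T (fun m => phase m (x - y) - \sum_(i < k) ctr i * phase m v`_i))%:E)%E.
Proof.
move=> c0 T0; under eq_integral do rewrite smooth_indic_tilted_box//.
have mQ := measurable_centred_box (fun _ : 'I_d => 0) (fun=> T).
pose A (m : 'rV[int]_k) := (N ^ k)%:R^-1 *
  \prod_(i < k) sinc_int (phase m v`_i) (Num.max 0 (h i)).
pose th (m : 'rV[int]_k) := phase m (x - y) - \sum_(i < k) ctr i * phase m v`_i.
have sE s : c * (\sum_(p : {ffun 'I_k -> 'I_N} * {ffun 'I_k -> 'I_N})
      A (freq p.1 - freq p.2) *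
      cos (phase (freq p.1 - freq p.2) (x + lincomb w s - y) -
           \sum_(i < k) ctr i * phase (freq p.1 - freq p.2) v`_i)) =
    \sum_(p : {ffun 'I_k -> 'I_N} * {ffun 'I_k -> 'I_N})
      (c * A (freq p.1 - freq p.2)) * cos (th (freq p.1 - freq p.2) +
        \sum_(j < d) s 0 j * phase (freq p.1 - freq p.2) w`_j).
  rewrite mulr_sumr; apply: eq_bigr => p _; rewrite mulrA; congr (_ * cos _).
  by rewrite /th addrAC (phaseD _ (x - y)) phase_lincomb; ring.
under eq_integral do rewrite sE.
rewrite (integral_finite_lincomb _ (r := fun p : {ffun 'I_k -> 'I_N} * {ffun 'I_k -> 'I_N} =>
  \prod_(j < d) sinc_int (phase (freq p.1 - freq p.2) w`_j) (Num.max 0 T) *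
    cos (th (freq p.1 - freq p.2) +
      \sum_(j < d) 0 * phase (freq p.1 - freq p.2) w`_j)))//; last 2 first.
- by move=> p; exact: integrable_cos_centred_box.
- by move=> p; exact: integral_cos_centred_box.
congr (_%:E); rewrite /fejer_flow mulr_sumr; apply: eq_bigr => p _.
rewrite (max_idPr T0) [\sum_(j < d) 0 * _]big1 ?addr0; last by move=> j _; rewrite mul0r.
by rewrite !mulrA.
Qed.

End flow.

(** The phases matter only through [th 0 = 0] and the bound 1 on cosines, so one constant serves all
    starting points and all positions of the parallelotope. *)
Lemma fejer_flow_le (R : realType) (d k : nat) (w : d.-tuple 'rV[R]_k) (v : k.-tuple 'rV[R]_k)
    (eps : R) :
  strongly_diophantine w v -> 0 < eps ->
  exists2 C : R, 0 < C & forall N (h : 'I_k -> R) (T : R) (th : 'rV[int]_k -> R),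
    (0 < N)%N -> th 0 = 0 ->
    `|fejer_flow w v N h T th - (\prod_i (2 * Num.max 0 (h i))) * (2 * T) ^+ d|
      <= (\prod_i (1 + 2 * Num.max 0 (h i))) * (C * N%:R `^ eps).
Proof.
move=> hdioph eps0; have [C C0 HC] := dioph_sum_le hdioph eps0.
exists C => // N h T th N0 th0.
(* The pairs [J = L] give the main term; for fixed [L], the frequencies [J - L] are
   distinct, and averaging over the [N ^ k] values of [L] cancels the normalisation. *)
pose t m := \prod_(i < k) sinc_int (phase m v`_i) (Num.max 0 (h i)) *
      \prod_(j < d) sinc_int (phase m w`_j) T * cos (th m).
set B := \prod_i (1 + _).
have B0 : 0 <= B by apply: prodr_ge0 => i _; rewrite addr_ge0// mulr_ge0// le_max lexx.
have tB m : m != 0 -> `|t m| <= B * dioph_weight w v m.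
  move=> m0; rewrite /t normrM -[leRHS]mulr1 ler_pM//; last exact: cos_max.
  rewrite normrM /dioph_weight mulrA ler_pM//.
    rewrite normr_prod /B -big_split/=; apply: ler_prod => i _; rewrite normr_ge0/=.
    by rewrite phase_dotr sinc_int_le// le_max lexx.
  rewrite normr_prod; apply: ler_prod => j _; rewrite normr_ge0/= phase_dotr dotrC.
  by apply: sinc_int_le_inv; exact: (dioph_neq0 hdioph).
have t0 : t 0 = (\prod_i (2 * Num.max 0 (h i))) * (2 * T) ^+ d.
  rewrite /t th0 cos0 mulr1; congr (_ * _).
    by apply: eq_bigr => i _; rewrite phase0 /sinc_int eqxx.
  rewrite -[d in RHS]card_ord -prodr_const; apply: eq_bigr => j _.
  by rewrite phase0 /sinc_int eqxx.
have Nk0 : (N ^ k)%:R != 0 :> R by rewrite pnatr_eq0 expn_eq0 (gtn_eqF N0).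
have -> : fejer_flow w v N h T th = (N ^ k)%:R^-1 *
    \sum_(L : {ffun 'I_k -> 'I_N}) \sum_(J : {ffun 'I_k -> 'I_N}) t (freq J - freq L).
  rewrite /fejer_flow -mulr_sumr exchange_big/=; congr (_ * _).
  by rewrite (pair_bigA _ (fun J L => t (freq J - freq L))).
have -> : \sum_(L : {ffun 'I_k -> 'I_N}) \sum_(J : {ffun 'I_k -> 'I_N}) t (freq J - freq L) =
    (N ^ k)%:R * t 0 + \sum_(L : {ffun 'I_k -> 'I_N}) \sum_(J | J != L) t (freq J - freq L).
  rewrite -card_idx mulr_natl -sumr_const -big_split/=; apply: eq_bigr => L _.
  by rewrite (bigD1 L)//= subrr.
rewrite t0 mulrDr mulKf// addrAC subrr add0r.
rewrite normrM ger0_norm ?invr_ge0// ler_pdivrMl; last by rewrite ltr0n expn_gt0 N0.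
apply: le_trans (ler_norm_sum _ _ _) _.
rewrite -card_idx mulr_natl -sumr_const; apply: ler_sum => L _.
apply: le_trans (ler_norm_sum _ _ _) _.
apply: le_trans (ler_wpM2l B0 (HC _ L N0)).
rewrite mulr_sumr; apply: ler_sum => J JL; apply: tB.
by rewrite subr_eq0 (inj_eq (@freq_inj _ _)).
Qed.

(** Replacing the factors one at a time changes the product each time by at most [e] times the other
    factors, each of which is below its [1 + a' i]. *)
Lemma prod_diff_le (R : realType) n (e : R) (a a' : 'I_n -> R) :
  (forall i, 0 <= a i <= a' i) -> (forall i, a' i <= a i + e) ->
  \prod_i a' i - \prod_i a i <= n%:R * e * \prod_i (1 + a' i).
Proof.
elim: n a a' => [|n IHn] a a' aa' a'e; first by rewrite !big_ord0 subrr !mul0r.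
rewrite !big_ord_recl.
have := IHn (fun i => a (lift ord0 i)) (fun i => a' (lift ord0 i))
  (fun i => aa' _) (fun i => a'e _).
set P' := \prod_i a' _; set P := \prod_i a _; set Q := \prod_i (1 + _) => IH.
have /andP[a0 a0'] := aa' ord0; have ae := a'e ord0.
have e0 : 0 <= e by lra.
have P'Q : P <= Q.
  apply: ler_prod => i _; have /andP[ai ai'] := aa' (lift ord0 i).
  by rewrite ai/=; lra.
have P0 : 0 <= P by apply: prodr_ge0 => i _; have /andP[] := aa' (lift ord0 i).
have n0 : 0 <= n%:R :> R by [].
rewrite -natr1.
have h1 : a' ord0 * (P' - P) <= a' ord0 * (n%:R * e * Q) by rewrite ler_wpM2l//; lra.
have h2 : (a' ord0 - a ord0) * P <= e * Q by apply: ler_pM; lra.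
have h3 : 0 <= n%:R * e * Q by rewrite !mulr_ge0//; lra.
have h4 : 0 <= a' ord0 * (e * Q) by rewrite !mulr_ge0//; lra.
nra.
Qed.

(** * Visits as integrals over the flow parameters *)

Section visits.
Variables (R : realType) (d k : nat) (w : d.-tuple 'rV[R]_k).
Hypothesis wfree : free w.

Let Q T := centred_box (fun _ : 'I_d => 0 : R) (fun=> T).

Lemma centred_box0E T : Q T = [set a : 'rV[R]_d | forall i, `|a 0 i| <= T].
Proof.
apply/seteqP; split => a /= aT i; have := aT i;
  by rewrite /= in_itv/= !add0r ler_norml.
Qed.

Lemma preimage_span_box T : lincomb w @^-1` (span_box w T) = Q T.
Proof.
rewrite centred_box0E; apply/seteqP; split => a /=; last by move=> aT; exists a.
by move=> [a' aT'] /(lincomb_inj wfree) <-.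
Qed.

(** An image need not be measurable a priori, so the box is rewritten as a preimage: with [P] a
    right inverse of [W], the coordinates [z *m P] lie in the box and [z *m P *m W = z] expresses
    membership in the span. *)
Lemma measurable_span_box T : measurable (span_box w T).
Proof.
set W := basis_mx w; pose P := pinvmx W.
have WP : W *m P = 1%:M by apply: mulmxVp; exact: basis_mx_free.
have -> : span_box w T = [set z : 'rV[R]_k | Q T (z *m P)] `&`
    [set z | rV_box (fun=> [set 0 : R]) (z *m (P *m W - 1%:M))].
  apply/seteqP; split => z.
    move=> [a aT <-]; rewrite -centred_box0E in aT; split => /=.
      by rewrite lincombE -mulmxA WP mulmx1.
    move=> i /=; rewrite lincombE mulmxBr mulmx1 mulmxA -[_ *m P]mulmxA WP mulmx1 subrr.
    by rewrite mxE.
  move=> [/= zQ z0]; exists (z *m P); first by rewrite -centred_box0E.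
  apply/eqP; rewrite -subr_eq0 lincombE -mulmxA -{2}[z]mulmx1 -mulmxBr.
  by apply/eqP/rowP => i; rewrite [LHS]z0 mxE.
apply: measurableI.
  rewrite -[X in measurable X]setTI; apply: (@measurable_mulmxr R k d P) => //.
  exact: measurable_centred_box.
rewrite -[X in measurable X]setTI; apply: (@measurable_mulmxr R k k _) => //.
by apply: measurable_rV_box => i; exact: measurable_set1.
Qed.

Let g := Num.sqrt (\det (gram w)).

Lemma lebesgue_span_box T : 0 <= T ->
  lebesgue_span w (span_box w T) = (g * (2 * T) ^+ d)%:E.
Proof.
move=> T0; rewrite /lebesgue_span /pushforward preimage_span_box /mscale/= EFinM.
congr (_ * _)%E; rewrite [LHS](@lebesgue_centred_box R d) (max_idPr T0).
by rewrite prodr_const card_ord.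
Qed.

(** The Gram factor [g] is the one in [lebesgue_span_box], so the whole discrepancy is [g] times a
    discrepancy over the coefficient box. *)
Lemma visitsE T (A : set 'rV[R]_k) x : measurable A ->
  (visits w T (@torus_pi R k @` A) x =
   g%:E * \int[lebesgue_rV d]_(s in Q T)
     (\1_(@torus_pi R k @` A) (torus_pi (x + lincomb w s)))%:E)%E.
Proof.
move=> mA; rewrite /visits.
have mU : measurable_fun setT (fun t : 'rV[R]_k =>
    (\1_(@torus_pi R k @` A) (torus_pi (x + t)))%:E : \bar R).
  rewrite (_ : (fun t => _) = fun t : 'rV[R]_k =>
      (\1_(@torus_pi R k @^-1` (@torus_pi R k @` A)) (t + x))%:E); last first.
    by apply/funext => t; rewrite !indicE addrC.
  have mi := @measurable_indicE R _ _ _ (measurable_torus_pi_preimage mA).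
  exact: (measurableT_comp mi (measurable_rV_addr x)).
rewrite (ge0_integral_pushforward (measurable_lincomb w))//; first last.
- exact: measurable_funTS.
- exact: measurable_span_box.
have mQ : measurable (Q T) by exact: measurable_centred_box.
rewrite preimage_span_box ge0_integral_mscale//; last 2 first.
- by apply: measurable_funTS; apply: (measurableT_comp mU); exact: measurable_lincomb.
- by move=> t _; exact: indicE_ge0.
Qed.
End visits.

(** * Two-sided bounds from enlarged and shrunk parallelotopes *)

Lemma int_vecN (R : realType) n (m : 'rV[int]_n) : int_vec R (- m) = - int_vec R m.
Proof. by apply/rowP => i; rewrite /int_vec !mxE intrN. Qed.

Lemma mulmx_bound (R : realType) k (V : 'M[R]_k) : exists2 K : R, 0 <= K &
  forall (rho : R) (u : 'rV[R]_k), (forall i, `|u 0 i| <= rho) ->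
    forall j, `|(u *m V) 0 j| <= K * rho.
Proof.
exists (\sum_i \sum_j `|V i j|); first by rewrite sumr_ge0// => i _; rewrite sumr_ge0.
move=> rho u uo j; rewrite mxE mulr_suml; apply: le_trans (ler_norm_sum _ _ _) _.
apply: ler_sum => i _; rewrite normrM mulrC ler_pM//.
by rewrite (bigD1 j)//= lerDl sumr_ge0.
Qed.

Lemma tilted_box_shift (R : realType) k (v : k.-tuple 'rV[R]_k) y ctr (h : 'I_k -> R) r p u :
  (forall j, `|(u *m invmx (basis_mx v)) 0 j| <= r) ->
  tilted_box v y ctr h p -> tilted_box v y ctr (fun i => h i + r) (p + u).
Proof.
move=> ur pb i.
have E : ((p + u - y) *m invmx (basis_mx v)) 0 i =
    ((p - y) *m invmx (basis_mx v)) 0 i + (u *m invmx (basis_mx v)) 0 i.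
  by rewrite addrAC mulmxDl mxE.
have := pb i; have := ur i; rewrite /= E !in_itv/= ler_norml => /andP[a1 a2] /andP[b1 b2].
by apply/andP; split; lra.
Qed.

Section sandwich.
Variables (R : realType) (d k : nat) (w : d.-tuple 'rV[R]_k) (v : k.-tuple 'rV[R]_k).
Local Notation W := (basis_mx v).
Variables (c : R) (N : nat).
Hypothesis Wu : W \in unitmx.
Hypothesis Hc : forall h : 'rV[R]_k -> \bar R,
    measurable_fun setT h -> (forall x, 0 <= h x)%E ->
    (\int[lebesgue_rV k]_x h x = c%:E * \int[lebesgue_rV k]_a h (a *m W)%R)%E.
Hypotheses (c0 : 0 <= c) (N0 : (0 < N)%N).

Lemma measurable_smooth_flow y ctr h x :
  measurable_fun setT (fun s => smooth_indic (fejer N) (tilted_box v y ctr h) (x + lincomb w s)).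
Proof.
have -> : (fun s => smooth_indic (fejer N) (tilted_box v y ctr h) (x + lincomb w s)) =
    fun s => (smooth_indic (fejer N) (tilted_box v y ctr h) \o (fun z => z + x)) (lincomb w s).
  by apply/funext => s /=; rewrite addrC.
apply: (measurableT_comp _ (measurable_lincomb w)).
apply: (measurableT_comp _ (measurable_rV_addr x)).
rewrite (_ : smooth_indic _ _ = fun z => (c * \sum_(p : {ffun 'I_k -> 'I_N} * {ffun 'I_k -> 'I_N})
    ((N ^ k)%:R^-1 * \prod_(i < k) sinc_int (phase (freq p.1 - freq p.2) v`_i) (Num.max 0 (h i))) *
      cos ((phase (freq p.1 - freq p.2) (- y) -
           \sum_(i < k) ctr i * phase (freq p.1 - freq p.2) v`_i) +
           phase (freq p.1 - freq p.2) z))%:E).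
  apply/measurable_EFinP; apply: measurable_funM => //; apply: measurable_sum => p.
  by apply: measurable_funM => //; exact: measurable_cos_sum.
apply/funext => z; rewrite (smooth_indic_tilted_box Wu Hc N0); congr (_ * _)%:E.
by apply: eq_bigr => p _; rewrite phaseD -addrA [phase _ z + _]addrC.
Qed.

Let mQ T : measurable (centred_box (fun _ : 'I_d => 0 : R) (fun=> T)).
Proof. exact: measurable_centred_box. Qed.

(** The shrunk box inherits injectivity as a subset of the given one. The enlarged box may overlap
    its lattice translates, which the upper bound tolerates. *)
Lemma flow_sandwich y ctr h x (T rho r : R) :
  0 <= T -> 0 < rho -> rho <= 4^-1 ->
  (forall u : 'rV[R]_k, (forall i, `|u 0 i| <= rho) ->
    forall j, `|(u *m invmx W) 0 j| <= r) ->
  set_inj (tilted_box v y ctr h) (@torus_pi R k) ->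
  let th m := phase m (x - y) - \sum_(i < k) ctr i * phase m v`_i in
  let tau := k%:R / (N%:R * (cos 1 * rho) ^+ 2) in
  exists2 V : R,
    (\int[lebesgue_rV d]_(s in centred_box (fun=> 0%R) (fun=> T))
      (\1_(@torus_pi R k @` tilted_box v y ctr h) (torus_pi (x + lincomb w s)))%:E = V%:E)%E &
    c * fejer_flow w v N (fun i => h i - r) T th - tau * (2 * T) ^+ d <= V <=
    c * fejer_flow w v N (fun i => h i + r) T th + tau * (2 * T) ^+ d.
Proof.
move=> T0 rho0 rho4 ur inj th tau.
pose kappa := (cos 1 * rho) ^+ 2.
have kappa0 : 0 < kappa by rewrite exprn_gt0// mulr_gt0// cos1_gt0.
have tau0 : 0 <= tau by rewrite divr_ge0// mulr_ge0// ltW.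
have mF := @measurable_fejer R k N.
have F0 := @fejer_ge0 R k N.
have Fp := @fejer_periodic R k N.
have F1 := @integral_fejer R k N N0.
have Ft := @fejer_tail R k N N0 _ kappa0.
have mN := @measurable_near_lattice R k kappa.
set A := tilted_box v y ctr h.
have mA (h' : 'I_k -> R) := @measurable_tilted_box R k v y ctr h'.
(* Testing the hypothesis at [u = 0] gives [0 <= r] as soon as there is a coordinate to test. *)
have r0 : 0 <= r \/ k = 0%N.
  case: (posnP k) => [|k0]; first by right.
  left; apply: le_trans (ur 0 _ (Ordinal k0)); first exact: normr_ge0.
  by move=> i; rewrite mxE normr0 ltW.
set U := @torus_pi R k @` A.
set Q := centred_box (fun _ : 'I_d => 0 : R) (fun=> T).
have mU : measurable_fun setT (fun s => (\1_U (torus_pi (x + lincomb w s)))%:E : \bar R).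
  rewrite (_ : (fun s => _) = fun s => ((fun z : 'rV[R]_k =>
      (\1_(@torus_pi R k @^-1` U) z)%:E) \o (fun z => z + x)) (lincomb w s)); last first.
    by apply/funext => t; rewrite /= !indicE addrC.
  apply: (measurableT_comp _ (measurable_lincomb w)).
  apply: (measurableT_comp _ (measurable_rV_addr x)).
  by apply: measurable_indicE; apply: measurable_torus_pi_preimage; exact: mA.
have smooth0 (B : set 'rV[R]_k) (z : 'rV[R]_k) : (0 <= smooth_indic (fejer N) B z :> \bar R)%E.
  apply: integral_ge0 => p _; apply: mule_ge0; last exact: indicE_ge0.
  by rewrite lee_fin F0.
have tauI : (\int[lebesgue_rV d]_(s in Q) tau%:E = (tau * (2 * T) ^+ d)%:E)%E.
  rewrite integral_cst//; last exact: mQ.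
  rewrite [X in (_ * X)%E](@lebesgue_centred_box R d) (max_idPr T0).
  by rewrite prodr_const card_ord.
have mtau : measurable_fun setT (fun _ : 'rV[R]_d => tau%:E : \bar R) by [].
have tau0E : (0 <= tau%:E)%E by rewrite lee_fin.
have flowE h' := integral_smooth_flow w Wu Hc N0 y ctr h' x c0 T0.
have mH h' := measurable_smooth_flow y ctr h' x.
have mQT : measurable Q := mQ T.
have mHQ h' := measurable_funS measurableT (@subsetT _ Q) (mH h').
have mUQ := measurable_funS measurableT (@subsetT _ Q) mU.
have mtauQ := measurable_funS measurableT (@subsetT _ Q) mtau.
set V := (\int[lebesgue_rV d]_(s in Q) _)%E.
have upper : (V <= (c * fejer_flow w v N (fun i => h i + r) T th + tau * (2 * T) ^+ d)%:E)%E.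
  rewrite EFinD -flowE -tauI -ge0_integralD//.
  apply: ge0_le_integral => //; first exact: emeasurable_funD.
  move=> s _; apply: (indic_le_smooth mF F0 Fp mN F1 Ft); first exact: mA.
  move=> p q Ap /(near_latticeP rho0 rho4)[m qm]; exists m.
  by rewrite -addrA; apply: tilted_box_shift => //; exact: ur.
have lower : ((c * fejer_flow w v N (fun i => h i - r) T th)%:E <= V + (tau * (2 * T) ^+ d)%:E)%E.
  rewrite -flowE -tauI -ge0_integralD//.
  apply: ge0_le_integral => //; first exact: emeasurable_funD.
  move=> s _; apply: (smooth_le_indic mF F0 Fp mN F1 Ft); first exact: mA.
    apply: (sub_in2 _ inj) => p; rewrite !inE => Ap i.
    have := Ap i; rewrite /= !in_itv/= => /andP[? ?].
    case: r0 => [r0|k0]; first by apply/andP; split; lra.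
    by exfalso; have := leq_ltn_trans (leq0n i) (ltn_ord i); rewrite k0.
  move=> p q Ap /(near_latticeP rho0 rho4)[m qm]; exists (- m).
  rewrite int_vecN -addrA -opprD.
  (* The given box is the enlargement by [r] of the shrunk one, so the same shift lemma serves for
     both bounds. *)
  rewrite /A (_ : h = fun i => (h i - r) + r); last by apply/funext => i; rewrite subrK.
  by apply: tilted_box_shift => // j; rewrite mulNmx mxE normrN; exact: ur.
have V0 : (0 <= V)%E by apply: integral_ge0 => s _; exact: indicE_ge0.
have Vfin : V \is a fin_num by rewrite ge0_fin_numE// (le_lt_trans upper)// ltry.
exists (fine V); first by rewrite fineK.
by move: upper lower; rewrite -(fineK Vfin) -EFinD !lee_fin lerBlDr => -> ->.
Qed.
End sandwich.

(** * Proof of the discrepancy bound *)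

Lemma enorm_gt0 (R : realType) k (u : 'rV[R]_k) : u != 0 -> 0 < enorm u.
Proof.
move=> /rV0Pn[i ui]; rewrite sqrtr_gt0 dotrE (bigD1 i)//= ltr_wpDr//.
  by apply: sumr_ge0 => j _; rewrite -expr2 sqr_ge0.
by rewrite -expr2 exprn_even_gt0.
Qed.

Lemma enormZ (R : realType) k (a : R) (u : 'rV[R]_k) : enorm (a *: u) = `|a| * enorm u.
Proof.
rewrite /enorm (_ : dotr (a *: u) (a *: u) = a ^+ 2 * dotr u u).
  by rewrite sqrtrM ?sqr_ge0// sqrtr_sqr.
by rewrite !dotrE mulr_sumr; apply: eq_bigr => i _; rewrite !mxE; ring.
Qed.

Lemma parallelotopeE (R : realType) k (v : k.-tuple 'rV[R]_k) (b y : 'rV[R]_k) :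
  basis_mx v \in unitmx ->
  [set u + y | u in parallelotope v b] =
  tilted_box v y (fun i => b 0 i / 2) (fun i => b 0 i / 2).
Proof.
move=> Wu; have E i : b 0 i / 2 + b 0 i / 2 = b 0 i by lra.
apply/seteqP; split => z.
  move=> [_ [a ab <-] <-] i /=.
  by rewrite lincombE addrK mulmxK// in_itv/= subrr E; exact: ab.
move=> zb; exists ((z - y) *m invmx (basis_mx v) *m basis_mx v); last first.
  by rewrite mulmxKV// subrK.
exists ((z - y) *m invmx (basis_mx v)); last by rewrite lincombE.
by move=> i; have := zb i; rewrite /= in_itv/= subrr E.
Qed.

(* A Fejer kernel of degree about [T ^ (3 d)] makes the smoothing error [O(1)]. *)
Lemma exists_degree (R : realType) (T : R) (d : nat) (delta : R) : 1 < T -> (0 < d)%N ->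
  0 < delta -> exists N : nat, [/\ (0 < N)%N, (T ^+ d) ^+ 3 <= N%:R &
    N%:R `^ (delta / (3 * d)%:R) <= 2 `^ (delta / (3 * d)%:R) * T `^ delta].
Proof.
move=> T1 d0 delta0; set X := T ^+ d ^+ 3.
have X1 : 1 <= X by rewrite !exprn_ege1// ltW.
have X0 : 0 <= X by lra.
exists (Num.truncn X).+1; split => //; first by rewrite ltW// truncnS_gt.
have NX : (Num.truncn X).+1%:R <= 2 * X.
  by rewrite -natr1; have := truncn_le X; rewrite X0; lra.
have e0 : 0 <= delta / (3 * d)%:R by rewrite divr_ge0// ltW.
apply: (@le_trans _ _ ((2 * X) `^ (delta / (3 * d)%:R))).
  by apply: ge0_ler_powR => //; rewrite nnegrE// mulr_ge0.
rewrite powRM// ler_wpM2l ?powR_ge0//.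
rewrite /X -exprM mulnC -powR_mulrn; last by lra.
by rewrite -powRrM mulrCA mulfV ?mulr1// pnatr_eq0 muln_eq0 -lt0n.
Qed.

Lemma free_prefix (R : realType) (d k : nat) (v : k.-tuple 'rV[R]_k) (w : d.-tuple 'rV[R]_k) :
  (d <= k)%N -> (forall i : 'I_d, w`_i = v`_i) -> free v -> free w.
Proof.
move=> dk hw; rewrite -{1}(cat_take_drop d v) => /catl_free.
suff -> : take d v = w by [].
apply: (@eq_from_nth _ 0) => [|i]; first by rewrite size_takel ?size_tuple.
rewrite size_takel ?size_tuple// => id; rewrite nth_take//.
by rewrite -(hw (Ordinal id)).
Qed.

(** The real arithmetic of the three errors: the change of volume gives the term with [L], the
    nonzero frequencies the term with [C1], and the tail of the kernel the term with [cos 1]. *)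
Lemma discrepancy_bound (R : realType) (d k N : nat) (w : d.-tuple 'rV[R]_k)
    (v : k.-tuple 'rV[R]_k) (c C1 L T eps delta V : R) (b : 'I_k -> R)
    (th : 'rV[int]_k -> R) :
  let D : R := 2 ^+ d in
  let X := T ^+ d in
  let rho := 4^-1 / X in
  let r := L * rho in
  let B := \prod_i (1 + (b i + 2 * r)) in
  let tau := k%:R / (N%:R * (cos 1 * rho) ^+ 2) in
  0 <= c -> 0 <= C1 -> 0 <= L -> 1 < T -> (forall i, 0 < b i) ->
  (0 < N)%N -> X ^+ 3 <= N%:R -> 0 < delta ->
  N%:R `^ eps <= 2 `^ eps * T `^ delta ->
  (forall h : 'I_k -> R,
    `|fejer_flow w v N h T th - (\prod_i (2 * Num.max 0 (h i))) * (2 * T) ^+ d|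
      <= (\prod_i (1 + 2 * Num.max 0 (h i))) * (C1 * N%:R `^ eps)) ->
  c * fejer_flow w v N (fun i => b i / 2 - r) T th - tau * (2 * T) ^+ d <= V <=
    c * fejer_flow w v N (fun i => b i / 2 + r) T th + tau * (2 * T) ^+ d ->
  `|V - c * (\prod_i b i) * (2 * T) ^+ d| <=
    (c * B * (k%:R * L * D / 2 + C1 * 2 `^ eps) + 16 * k%:R * D / cos 1 ^+ 2) * T `^ delta.
Proof.
move=> D X rho r B tau c0 C10 L0 T1 b0 N0 XN delta0 Ne HF /andP[Vl Vu].
have X1 : 1 <= X by rewrite exprn_ege1// ltW.
have X0 : 0 < X by lra.
have D0 : 0 < D by rewrite exprn_gt0.
have c1 := @cos1_gt0 R.
have rho0 : 0 < rho by rewrite divr_gt0.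
have r0 : 0 <= r by rewrite mulr_ge0// ltW.
have TD : (2 * T) ^+ d = D * X by rewrite exprMn.
have Td1 : 1 <= T `^ delta.
  by rewrite -(powRr0 T); apply: ler_powR; rewrite ltW.
have tauK : tau * (2 * T) ^+ d <= 16 * k%:R * D / cos 1 ^+ 2.
  have N0' : 0 < N%:R :> R by rewrite ltr0n.
  (* Of the three factors [X], two come from the inverse square of [rho], together with 16, and one
     from [(2 * T) ^+ d]; the lower bound on [N] absorbs them. *)
  rewrite (_ : tau * _ = (16 * k%:R * D / cos 1 ^+ 2) * (X ^+ 3 / N%:R)); last first.
    by rewrite /tau /rho TD; field; rewrite !gt_eqF.
  rewrite ler_piMr// ?ler_pdivrMr ?mul1r//.
  by rewrite divr_ge0// ?sqr_ge0// !mulr_ge0// ltW.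
(* As [rho] is inverse to [X], moving the faces costs a bounded amount over the whole box of
   times. *)
have rX : 2 * r * (D * X) = L * D / 2 by rewrite /r /rho; field; rewrite gt_eqF.
clearbody r.
have B0 : 0 <= B by apply: prodr_ge0 => i _; have := b0 i; lra.
set P := \prod_i b i.
pose hp i := b i / 2 + r; pose hm i := b i / 2 - r.
have hpE i : 2 * Num.max 0 (hp i) = b i + 2 * r.
  by rewrite (max_idPr _) /hp; have := b0 i; lra.
(* A side shorter than [2 * r] shrinks to nothing; its clipped length 0 is still within [2 * r] of
   [b i]. *)
have hmE i : 0 <= 2 * Num.max 0 (hm i) <= b i /\ b i <= 2 * Num.max 0 (hm i) + 2 * r.
  have := b0 i; rewrite /hm; case: (leP 0 (b i / 2 - r)) => hh bi.
    by split; [apply/andP; split|]; lra.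
  by split; [apply/andP; split|]; lra.
have HFp := HF hp; have HFm := HF hm.
have Bp : \prod_i (1 + 2 * Num.max 0 (hp i)) = B by apply: eq_bigr => i _; rewrite hpE.
have Bm : \prod_i (1 + 2 * Num.max 0 (hm i)) <= B.
  apply: ler_prod => i _; have [/andP[? ?] ?] := hmE i; have := b0 i.
  by move=> ?; apply/andP; split; lra.
have Pp : \prod_i (2 * Num.max 0 (hp i)) - P <= k%:R * (2 * r) * B.
  rewrite -Bp; apply: prod_diff_le => i; rewrite hpE; have := b0 i; last by lra.
  by move=> ?; apply/andP; split; lra.
have Pm : P - \prod_i (2 * Num.max 0 (hm i)) <= k%:R * (2 * r) * B.
  apply: (@le_trans _ _ (k%:R * (2 * r) * \prod_i (1 + b i))).
    by apply: prod_diff_le => i; have [] := hmE i.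
  rewrite ler_wpM2l// ?mulr_ge0//; apply: ler_prod => i _.
  by have := b0 i => ?; apply/andP; split; lra.
rewrite Bp in HFp.
have E0 : 0 <= C1 * N%:R `^ eps by rewrite mulr_ge0// powR_ge0.
have E1 : C1 * N%:R `^ eps <= C1 * 2 `^ eps * T `^ delta.
  by rewrite -mulrA ler_wpM2l.
set FP := fejer_flow w v N hp T th in HFp; set FM := fejer_flow w v N hm T th in HFm.
have {}HFm := le_trans HFm (ler_wpM2r E0 Bm).
have {}HFp := le_trans HFp (ler_wpM2l B0 E1).
have {}HFm := le_trans HFm (ler_wpM2l B0 E1).
rewrite TD in HFp HFm *; rewrite TD in Vl Vu tauK.
have DX0 : 0 <= D * X by rewrite mulr_ge0// ltW.
have {}Pp := ler_wpM2r DX0 Pp; have {}Pm := ler_wpM2r DX0 Pm.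
have kE : k%:R * (2 * r) * B * (D * X) = B * (k%:R * L * D / 2).
  rewrite (_ : k%:R * (2 * r) * B * (D * X) = B * k%:R * (2 * r * (D * X))); last ring.
  by rewrite rX; field.
rewrite kE in Pp Pm.
set PP := \prod_i (2 * Num.max 0 (hp i)) in Pp HFp.
set PM := \prod_i (2 * Num.max 0 (hm i)) in Pm HFm.
have G0 : 0 <= B * (k%:R * L * D / 2) by rewrite !mulr_ge0// ltW.
have G1 : B * (k%:R * L * D / 2) <= B * (k%:R * L * D / 2) * T `^ delta by rewrite ler_peMr.
set G := B * (k%:R * L * D / 2) in Pp Pm G0 G1.
set H := B * (C1 * 2 `^ eps * T `^ delta) in HFp HFm.
set K3 := 16 * _ * _ / _ in tauK *.
have K30 : 0 <= K3 by rewrite divr_ge0// ?sqr_ge0// !mulr_ge0// ltW.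
have K3T : K3 <= K3 * T `^ delta by rewrite ler_peMr.
rewrite (_ : (_ + K3) * T `^ delta = c * (G * T `^ delta + H) + K3 * T `^ delta); last first.
  by rewrite /G /H; ring.
move: HFp HFm; rewrite !ler_norml => /andP[HFp1 HFp2] /andP[HFm1 HFm2].
have {}Vl : c * FM - tau * (D * X) <= V by exact: Vl.
have {}Vu : V <= c * FP + tau * (D * X) by exact: Vu.
have up : c * FP <= c * (P * (D * X) + G * T `^ delta + H).
  by rewrite ler_wpM2l//; lra.
have lo : c * (P * (D * X) - G * T `^ delta - H) <= c * FM.
  by rewrite ler_wpM2l//; lra.
rewrite -(mulrA c P); apply/andP; split.
- move: lo; rewrite mulrBr mulrBr; lra.
- move: up; rewrite !mulrDr; lra.
Qed.

Theorem theorem1p4 (R : realType) (d k : nat) (hd : (1 <= d)%N)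
    (hdk : (d < k)%N) (v : k.-tuple 'rV[R]_k)
    (w : d.-tuple 'rV[R]_k) (hw : forall i : 'I_d, w`_i = v`_i)
    (hbasis : basis_of fullv v)
    (hstd : forall i : 'I_k, (d <= i)%N ->
      exists j : 'I_k, v`_i = delta_mx 0 j)
    (hdioph : strongly_diophantine w v)
    (delta : R) (hdelta : 0 < delta) :
  exists2 C : R, 0 < C &
    forall (x : 'rV[R]_k) (T : R), 1 < T ->
    forall (eta : R) (b : 'rV[R]_k) (U : set (torus R k)),
      aligned_parallelotope v b U ->
      (forall i : 'I_k, enorm (b 0 i *: v`_i) <= eta) ->
      (`|visits w T U x - lebesgue_torus U * lebesgue_span w (span_box w T)|
        <= (C * (1 + eta) ^+ k * T `^ delta)%:E)%E.
Proof.
have k0 : (0 < k)%N by apply: leq_ltn_trans hdk.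
have vfree : free v := basis_free hbasis.
have wfree : free w by apply: free_prefix vfree => //; exact: ltnW.
have Wu : basis_mx v \in unitmx by rewrite -row_free_unit; exact: basis_mx_free.
have [c c0 Hc] := ge0_integral_rV_mulmx Wu.
have [L L0 HL] := mulmx_bound (invmx (basis_mx v)).
pose eps := delta / (3 * d)%:R.
have eps0 : 0 < eps by rewrite divr_gt0// ltr0n muln_gt0.
have [C1 C10 HF] := fejer_flow_le hdioph eps0.
pose g := Num.sqrt (\det (gram w)); have g0 : 0 <= g by exact: sqrtr_ge0.
have vi0 i : 0 < enorm v`_(i : 'I_k).
  apply: enorm_gt0; apply: contraTneq vfree => vi0.
  have : v`_i \in v by rewrite mem_nth// size_tuple.
  by rewrite vi0 => v0; apply/negP => /free_not0 /(_ v0); rewrite eqxx.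
(* Each factor [1 + (b i + 2 * r)] is to be at most the factor here times [1 + eta]: the sidelength
   condition bounds [b i] by [eta] over the length of the basis vector, and [r <= L]. *)
pose C2 := \prod_(i < k) (1 + 2 * L + (enorm v`_i)^-1).
pose K := k%:R * L * 2 ^+ d / 2 + C1 * 2 `^ eps.
pose K3 := 16 * k%:R * 2 ^+ d / cos 1 ^+ 2 : R.
have C20 : 0 <= C2.
  by apply: prodr_ge0 => i _; rewrite !addr_ge0 ?invr_ge0 ?mulr_ge0 ?(ltW (vi0 i)).
have K0 : 0 <= K.
  by rewrite addr_ge0 ?mulr_ge0 ?powR_ge0 ?(ltW C10)// exprn_ge0.
have K30 : 0 <= K3 by rewrite divr_ge0 ?sqr_ge0// !mulr_ge0// exprn_ge0.
(* The summand 1 gives positivity without knowing that [g] or [c] is nonzero. *)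
exists (g * (c * C2 * K + K3) + 1).
  by rewrite ltr_wpDl// mulr_ge0// addr_ge0// !mulr_ge0.
move=> x T T1 eta b U [b0 [y [inj ->]]] bE.
have T0 : 0 <= T by lra.
rewrite (parallelotopeE b y Wu) in inj *.
set ctr := fun i : 'I_k => _ in inj *.
have mA := measurable_tilted_box v y ctr ctr.
have [N [N0 XN Ne]] := exists_degree T1 hd hdelta.
(* The quarter provides [rho <= 4^-1], as needed to pass from [near_lattice] to an actual
   distance. *)
pose X := T ^+ d; pose rho := 4^-1 / X; pose r := L * rho.
have X1 : 1 <= X by rewrite exprn_ege1// ltW.
have rho0 : 0 < rho by rewrite divr_gt0//; lra.
have rho4 : rho <= 4^-1 by rewrite ler_pdivrMr; [rewrite ler_peMr|lra].
have [V VE Vle] := flow_sandwich w Wu Hc c0 N0 x T0 rho0 rho4 (HL rho) inj.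
have eta0 : 0 <= eta.
  apply: le_trans (bE (Ordinal k0)); exact: sqrtr_ge0.
rewrite (visitsE wfree T x mA) VE lebesgue_torus_image// (lebesgue_span_box wfree T0).
rewrite [lebesgue_rV k _](lebesgue_tilted_box Wu Hc) -!EFinM -EFinB abse_EFin lee_fin.
have prodE : \prod_i (2 * Num.max 0 (ctr i)) = \prod_i b 0 i.
  apply: eq_bigr => i _; rewrite (max_idPr _) /ctr; last by rewrite divr_ge0// ltW.
  by field.
rewrite -/g prodE (_ : g * V - _ = g * (V - c * (\prod_i b 0 i) * (2 * T) ^+ d)); last ring.
rewrite normrM (ger0_norm g0).
have th0 : phase 0 (x - y) - \sum_(i < k) ctr i * phase 0 v`_i = 0.
  by rewrite phase0 sub0r big1 ?oppr0// => i _; rewrite phase0 mulr0.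
have := discrepancy_bound (b := fun i => b 0 i) c0 (ltW C10) L0 T1 b0 N0 XN hdelta Ne
  (fun h => HF _ _ _ _ N0 th0) Vle.
set B := \prod_i (1 + _) => VB.
have BC2 : B <= C2 * (1 + eta) ^+ k.
  rewrite -[k in _ ^+ k]card_ord -prodr_const -big_split/=; apply: ler_prod => i _.
  have bi := b0 i; have := bE i; rewrite enormZ gtr0_norm// -ler_pdivlMr// => be.
  have rL : r <= L by rewrite /r ler_piMr//; lra.
  have r0 : 0 <= r by rewrite mulr_ge0// ltW.
  have vV : 0 <= (enorm v`_i)^-1 by rewrite invr_ge0 ltW.
  have Le : 0 <= L * eta by rewrite mulr_ge0.
  apply/andP; split; first by rewrite -/r; lra.
  rewrite -/r; nra.
have eta1 : 1 <= (1 + eta) ^+ k by rewrite exprn_ege1//; lra.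
have T1d : 0 <= T `^ delta by exact: powR_ge0.
apply: (@le_trans _ _ (g * (c * C2 * K + K3) * (1 + eta) ^+ k * T `^ delta)).
  rewrite -!(mulrA g) ler_wpM2l//; apply: (le_trans VB).
  rewrite -/K -/K3 ler_wpM2r// mulrDl lerD//; last by rewrite ler_peMr.
  rewrite (_ : c * C2 * K * _ = c * (C2 * (1 + eta) ^+ k) * K); last ring.
  by rewrite ler_wpM2r// ler_wpM2l.
rewrite ler_wpM2r// ler_wpM2r//; first by rewrite exprn_ge0//; lra.
by rewrite lerDl.
Qed.
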